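(* Suppose that: (B) the stochastic kernel $\kappa(dx|s)=P(X_t\in dx\,|\,S_t=s)$ is weakly continuous in $s$ (product topology); (D) for every Borel $B\subset\mathbb{X}$, under any control policy, for almost every $(y,u)$, $P(X_t\in B|Y_{(-\infty,t]}=y,U_{(-\infty,t-1]}=u)=P(X_{t+1}\in B|Y_{(-\infty,t+1]}=y,U_{(-\infty,t]}=u)$. Let $U_t=\gamma(Y_{(-\infty,t]},U_{(-\infty,t-1]},R_t)$ be an optimal stationary policy for the average cost criterion, with $R_t$ an i.i.d. noise process, and let $g(y_{(-\infty,k]},u_{(-\infty,k-1]},x_k)=E[c(x_k,\gamma(y_{(-\infty,k]},u_{(-\infty,k-1]},R_k))]$, the expectation being over $R_k$. Let $\bar P$ denote an (invariant) process measure on $(Y_{(-\infty,k-1]},U_{(-\infty,k-1]},Y_k,X_k)$ under this policy, let $P_0$ be the marginal of the invariant measure on $(Y_{(-\infty,-1]},U_{(-\infty,-1]})$, and let $\mu$ be the given prior measure on $X_0$. If $P_0\times\mu\ll\bar P$ (absolute continuity when the past history is initialized independently of the state), then $$\lim_{T\to\infty}\frac1T E_{P_0\times\mu}\Big[\sum_{k=0}^{T-1}c\big(X_k,\gamma(Y_{(-\infty,k]},U_{(-\infty,k-1]},R_k)\big)\Big]=\int g(y_{(-\infty,0]},u_{(-\infty,-1]},x_0)\,\bar Q(dy_{(-\infty,0]},du_{(-\infty,-1]},dx_0)$$ for some invariant $\bar Q$. If $\bar P$ is an ergodic invariant measure attaining the optimal cost, then necessarily $\bar Q=\bar P$, and the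 optimal cost is attained.
   Context: Model: $\mathbb{X}$, $\mathbb{Y}$ are standard Borel (Polish) spaces and $\mathbb{U}$ is a compact metric action space. $X_{t+1}=F(X_t,U_t,W_t)$, $Y_t=G(X_t,V_t)$ with mutually independent i.i.d. noise sequences; $\mathcal{T}(B|x,u)=P(X_1\in B|X_0=x,U_0=u)$, $Q(C|x)=P(Y_0\in C|X_0=x)$. The stage cost $c:\mathbb{X}\times\mathbb{U}\to\mathbb{R}_+$ is bounded and continuous. Average cost: $\limsup_{N}\frac1N E[\sum_{t=0}^{N-1}c(X_t,U_t)]$. Infinite past: $\mathbb{Y}^{\mathbb{Z}_-}$, $\mathbb{U}^{\mathbb{Z}_-}$ are one-sided products over $\{\dots,-1,0\}$ with the product topology; $u_{(-\infty,-1]}$ is viewed as an element of $\mathbb{U}^{\mathbb{Z}_-}$. $S_t=(Y_{(-\infty,t]},U_{(-\infty,t-1]})$, $Z_t=(Y_{(-\infty,t]},U_{(-\infty,t-1]},X_t)$; $\kappa(dx|s)$ is the stochastic kernel $P(X_t\in dx|S_t=s)$. Under the stationary policy, $Z_t$ is a Markov chain: given $Z_t=z=(y,u,x)$, $U_t=\gamma(y,u,R_t)$ with $R_t$ independent of the past and of the system noise, $X_{t+1}\sim\mathcal{T}(\cdot|x,U_t)$, $Y_{t+1}\sim Q(\cdot|X_{t+1})$, and $Y_{t+1},U_t$ are appended to the histories. ''Invariant'' and ''ergodic'' refer to invariant probability measures of this chain, ergodic meaning extreme in the convex set of invariant measures. $P_0\times\mu$ denotes the initial law of $Z_0$ under which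 $(Y_{(-\infty,-1]},U_{(-\infty,-1]})\sim P_0$ is independent of $X_0\sim\mu$ and $Y_0\sim Q(\cdot|X_0)$. The optimal cost is $\inf_v\int c(x,u)\,v(dz,du)$ over probability measures $v$ on pairs $(z,u)$ with $z=(y_{(-\infty,0]},u_{(-\infty,-1]},x)$ that are invariant (the $z$-marginal of $v$ is reproduced after one step of the dynamics above started from $(Z_0,U_0)\sim v$) and satisfy conditional independence of $X_0$ and $U_0$ given $S_0$. *)

(* Defs.v *)
From HB Require Import structures.
From mathcomp Require Export all_boot all_order all_algebra.
From mathcomp Require Export all_classical all_reals all_analysis.
From mathcomp Require Export measurable_realfun.

Set Implicit Arguments.
Unset Strict Implicit.
Unset Printing Implicit Defensive.

Import Order.TTheory GRing.Theory Num.Theory.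
Import numFieldNormedType.Exports.

Local Open Scope classical_set_scope.
Local Open Scope ring_scope.

(* Metric spaces with a base point (required by [measurableType]); the second
   structure is moreover complete, so that it is a Polish space as soon as it
   is [separable]. *)
#[short(type="pmetricType")]
HB.structure Definition PointedMetric (K : numDomainType) :=
  { M of Metric K M & Pointed M }.

#[short(type="completeMetricType")]
HB.structure Definition CompleteMetric (K : numDomainType) :=
  { M of Metric K M & Complete M & Pointed M }.

Definition separable (T : topologicalType) :=
  exists2 D : set T, countable D & dense D.

Notation borel T := (g_sigma_algebraType (@open T)).

Section past.
Context d (T : measurableType d).

Definition coordinate_sets : set (set (nat -> T)) :=
  \bigcup_n preimage_set_system setT (fun y : nat -> T => y n) measurable.

End past.

(* T^{Z_-}, the coordinate at time -n being stored at index n.  It carries the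
   product sigma-algebra, which for separable metric T is the Borel
   sigma-algebra of the product topology {ptws nat -> T}. *)
Notation past T := (g_sigma_algebraType (@coordinate_sets _ T)).

Definition append (T : Type) (a : T) (y : nat -> T) : nat -> T :=
  fun n => if n is m.+1 then y m else a.

Definition drop_last (T : Type) (y : nat -> T) : nat -> T := fun n => y n.+1.

(* Range of S_t = (Y_(-oo,t], U_(-oo,t-1]): the two sequences have their origins
   of time at t and at t-1 respectively. *)
Notation history Y U := (past (borel Y) * past (borel U))%type.
(* Range of Z_t = (S_t, X_t). *)
Notation state X Y U := (history Y U * borel X)%type.

Section probability.
Context (R : realType) d (Omega : measurableType d) (P : probability Omega R).

(* f(s) is a version of P(E | S = s). *)
Definition is_cond_prob d' (T : measurableType d') (S : Omega -> T)
    (E : set Omega) (f : T -> \bar R) :=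
  [/\ measurable_fun [set: T] f, (forall s, 0 <= f s)%E &
      forall A, measurable A ->
        (\int[P]_(w in S @^-1` A) f (S w))%E = P (S @^-1` A `&` E)].

Definition cond_independent dA dB dT (TA : measurableType dA)
    (TB : measurableType dB) (T : measurableType dT)
    (A : Omega -> TA) (B : Omega -> TB) (S : Omega -> T) :=
  forall (C : set TA) (D : set TB) (f g : T -> \bar R),
    measurable C -> measurable D ->
    is_cond_prob S (A @^-1` C) f -> is_cond_prob S (B @^-1` D) g ->
    is_cond_prob S (A @^-1` C `&` B @^-1` D) (fun s => f s * g s)%E.

Definition sigma_of d' (T : measurableType d') (S : Omega -> T) :
    set (set Omega) :=
  preimage_set_system setT S measurable.

Definition mutually_independent (I : eqType) (H : I -> set (set Omega)) :=
  forall (s : seq I) (E : I -> set Omega), uniq s ->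
    (forall i, i \in s -> H i (E i)) ->
    P (\bigcap_(i in [set` s]) E i) = (\prod_(i <- s) P (E i))%E.

End probability.

Section model.
Context (R : realType) (X Y : completeMetricType R) (U : pmetricType R).
Context (dW dV : measure_display) (W : measurableType dW) (V : measurableType dV).
Context (PW : probability W R) (PV : probability V R).
Context (F : {mfun (borel X * borel U * W)%type >-> borel X}).
Context (G : {mfun (borel X * V)%type >-> borel Y}).
Context (c : X * U -> R).

(* The kernels T(.|x,u) and Q(.|x) of the model are the laws of F(x,u,w) and
   G(x,v) for w ~ PW and v ~ PV. *)
Definition next_state (z : state X Y U) (u : U) (w : W) (v : V) : state X Y U :=
  let x' : borel X := F (z.2, u, w) in
  ((append (G (x', v)) z.1.1, append u z.1.2), x').

(* Z_t0 from (Y_(-oo,t0-1], U_(-oo,t0-1]), X_t0 and V_t0, and conversely the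
   history before Y_t0 from Z_t0. *)
Definition initial_state (h : history Y U) (x : X) (v : V) : state X Y U :=
  ((append (G (x, v)) h.1, h.2), x).

Definition past_history (z : state X Y U) : history Y U :=
  (drop_last z.1.1, z.1.2).

Section process.
Context dO (Omega : measurableType dO) dN (N : measurableType dN).

(* For a process started at time t0, Y_t (t <= t0), U_t (t < t0) and X_t0 make
   up the initial state Z_t0; the other values before t0 are irrelevant. *)
Record process := Process {
  st : int -> {mfun Omega >-> borel X} ;
  obs : int -> {mfun Omega >-> borel Y} ;
  act : int -> {mfun Omega >-> borel U} ;
  wnoise : int -> {mfun Omega >-> W} ;
  vnoise : int -> {mfun Omega >-> V} ;
  rnoise : int -> {mfun Omega >-> N} }.

Definition history_at (p : process) (t : int) (om : Omega) : history Y U :=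
  (fun n => obs p (t - n%:Z) om, fun n => act p (t - 1 - n%:Z) om).

Definition state_at (p : process) (t : int) (om : Omega) : state X Y U :=
  (history_at p t om, st p t om).

(* Z_t0 and the noises W_t, V_(t+1), R_t, t >= t0 (V_t0 has served in Y_t0). *)
Definition innovation (p : process) (t0 : int)
    (i : option (nat + nat + nat)) : set (set Omega) :=
  match i with
  | None => sigma_of (state_at p t0)
  | Some (inl (inl n)) => sigma_of (wnoise p (t0 + n%:Z))
  | Some (inl (inr n)) => sigma_of (vnoise p (t0 + n.+1%:Z))
  | Some (inr n) => sigma_of (rnoise p (t0 + n%:Z))
  end.

(* From time t0 on, p follows the model under the randomized policy
   U_t = pol_t(S_t, R_t). *)
Definition controlled_from (t0 : int) (P : probability Omega R)
    (PN : probability N R)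
    (pol : int -> {mfun (history Y U * N)%type >-> borel U}) (p : process) :=
  [/\ forall t om, t0 <= t ->
        [/\ act p t om = pol t (history_at p t om, rnoise p t om),
            st p (t + 1) om = F (st p t om, act p t om, wnoise p t om) &
            obs p (t + 1) om = G (st p (t + 1) om, vnoise p (t + 1) om)],
      forall t, t0 <= t ->
        [/\ forall A, measurable A -> P (wnoise p t @^-1` A) = PW A,
            forall A, measurable A -> P (vnoise p (t + 1) @^-1` A) = PV A &
            forall A, measurable A -> P (rnoise p t @^-1` A) = PN A] &
      mutually_independent P (innovation p t0)].

(* Two-sided time: all of the infinite past has been generated by the model. *)
Definition controlled (P : probability Omega R) (PN : probability N R)
    (pol : int -> {mfun (history Y U * N)%type >-> borel U}) (p : process) :=
  forall t0, controlled_from t0 P PN pol p.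

Definition average_cost (P : probability Omega R) (p : process) : \bar R :=
  limn_esup (fun T : nat => (T%:R^-1)%:E *
    'E_P[fun om => (\sum_(k < T) c (st p k%:Z om, act p k%:Z om))%R])%E.

End process.

Section conditional_kernel.
Context (kappa : int -> R.-pker (history Y U) ~> (borel X)).

(* kappa_t(dx|s) = P(X_t in dx | S_t = s), under any control policy. *)
Definition is_cond_kernel :=
  forall dO (Omega : measurableType dO) (P : probability Omega R)
    dN (N : measurableType dN) (PN : probability N R)
    (pol : int -> {mfun (history Y U * N)%type >-> borel U})
    (p : process Omega N),
  controlled P PN pol p ->
  forall t (B : set (borel X)), measurable B ->
    is_cond_prob P (history_at p t) (st p t @^-1` B) (fun s => kappa t s B).

Definition weakly_continuous :=
  forall t (f : X -> R), continuous f -> (exists M, forall x, `|f x| <= M) ->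
    continuous (fun s : ({ptws nat -> Y} * {ptws nat -> U})%type =>
      \int[kappa t s]_x f x).

(* "Almost every (y,u)" refers to the law of S_t and to that of S_(t+1). *)
Definition time_invariant :=
  forall dO (Omega : measurableType dO) (P : probability Omega R)
    dN (N : measurableType dN) (PN : probability N R)
    (pol : int -> {mfun (history Y U * N)%type >-> borel U})
    (p : process Omega N),
  controlled P PN pol p ->
  forall t (B : set (borel X)), measurable B ->
    {ae P, forall om, kappa t (history_at p t om) B
                      = kappa (t + 1) (history_at p t om) B} /\
    {ae P, forall om, kappa t (history_at p (t + 1) om) B
                      = kappa (t + 1) (history_at p (t + 1) om) B}.

End conditional_kernel.

Definition occupation_measure (v : probability (state X Y U * borel U)%type R) :=
  (forall A : set (state X Y U), measurable A ->
     pushforward (v \x PW \x PV)%E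
       (fun p => next_state p.1.1.1 p.1.1.2 p.1.2 p.2) A
     = pushforward v fst A) /\
  cond_independent v (fun p => p.1.2) (fun p => p.2) (fun p => p.1.1).

Definition optimal_cost : \bar R :=
  ereal_inf [set (\int[v]_p (c (p.1.2, p.2))%:E)%E | v in occupation_measure].

Section stationary_policy.
Context dN (N : measurableType dN) (PN : probability N R).
Context (gamma : {mfun (history Y U * N)%type >-> borel U}).

Definition invariant_measure (nu : probability (state X Y U) R) :=
  forall A : set (state X Y U), measurable A ->
    pushforward (nu \x PN \x PW \x PV)%E
      (fun p => next_state p.1.1.1 (gamma (p.1.1.1.1, p.1.1.2)) p.1.2 p.2) A
    = nu A.

Definition ergodic_measure (nu : probability (state X Y U) R) :=
  invariant_measure nu /\
  forall (nu1 nu2 : probability (state X Y U) R) (l : R),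
    0 < l < 1 -> invariant_measure nu1 -> invariant_measure nu2 ->
    (forall A, measurable A ->
       nu A = (l%:E * nu1 A + (1 - l)%:E * nu2 A)%E) ->
    forall A, measurable A -> nu1 A = nu A /\ nu2 A = nu A.

Definition optimal_policy :=
  exists dO (Omega : measurableType dO) (P : probability Omega R)
    (p : process Omega N) (nu : probability (state X Y U) R),
  [/\ controlled_from 0 P PN (fun=> gamma) p,
      invariant_measure nu,
      forall A, measurable A -> P (state_at p 0 @^-1` A) = nu A &
      average_cost P p = optimal_cost].

Definition expected_cost (z : state X Y U) : \bar R :=
  (\int[PN]_r (c (z.2, gamma (z.1, r)))%:E)%E.

End stationary_policy.

(* Law of Z_0 when (Y_(-oo,-1], U_(-oo,-1]) ~ P0 is independent of X_0 ~ mu and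
   Y_0 ~ Q(.|X_0). *)
Definition init_law (P0 : probability (history Y U) R)
    (mu : probability (borel X) R) : set (state X Y U) -> \bar R :=
  pushforward (P0 \x mu \x PV)%E
    (fun p => initial_state p.1.1 p.1.2 p.2).

End model.

(* Main.v *)
(* Let K be the transition operator of the chain Z_t.  On the bounded functions
   with the L^2(Pbar) seminorm K is a contraction, so by von Neumann's mean
   ergodic theorem the Cesaro means of K^k f are Cauchy in L^2(Pbar).  Since the
   initial law nu is absolutely continuous with respect to Pbar, functions that
   are bounded and small in L^2(Pbar) have a small nu-integral: the means of
   nu(K^k f) converge, and their limit is a positive linear functional of f,
   continuous enough to be the integral with respect to a probability measure
   Qbar (Daniell), which is invariant.  If Pbar is extreme, applying this to the
   laws with densities h and 1 - h for arbitrary h shows that the means converge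
   to the constant Pbar(f) weakly, hence (being Cauchy) strongly in L^2(Pbar),
   hence under nu. *)
From HB Require Import structures.
Require Import Defs.
From mathcomp Require Import ring lra.

Set Implicit Arguments.
Unset Strict Implicit.
Unset Printing Implicit Defensive.

Import Order.TTheory GRing.Theory Num.Theory.
Import numFieldNormedType.Exports.

Local Open Scope classical_set_scope.
Local Open Scope ring_scope.

(** The density of the initial law with respect to [Pbar] is only integrable, so convergence in
    L^2(Pbar) does not by itself pass to the initial law. What passes is smallness in L^2(Pbar)
    together with a uniform bound: by Markov's inequality the function is then small off a set of
    small [Pbar]-measure, and such a set has small measure under the initial law too. This is why
    the argument stays with bounded functions, whose sup bounds K preserves. Bounded functions with
    that seminorm are in general not complete, so the L^2 limit of the Cesaro means is never formed.
    The mean ergodic theorem takes the form of a Cauchy property, and the only limits taken are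
    limits of integrals, which are real numbers. Orthogonal projection gives way to near-minimizers
    of the quadratic form f |-> int f^2 dPbar, and the inner product to the parallelogram law and a
    weighted Young inequality. *)

Definition cesaro (R : realType) (V : lmodType R) (K : V -> V) (n : nat)
    (x : V) : V := (n%:R^-1 : R) *: \sum_(k < n) iter k K x.

(** * Von Neumann's mean ergodic theorem for a quadratic form *)

Section mean_ergodic.
Context (R : realType) (V : lmodType R) (S : set V) (q : V -> R) (K : V -> V).
Hypothesis S0 : S 0.
Hypothesis SD : forall x y, S x -> S y -> S (x + y).
Hypothesis SZ : forall a x, S x -> S (a *: x).
Hypothesis SK : forall x, S x -> S (K x).
Hypothesis KD : forall x y, S x -> S y -> K (x + y) = K x + K y.
Hypothesis KZ : forall a x, S x -> K (a *: x) = a *: K x.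

Let SB x y : S x -> S y -> S (x - y).
Proof. by move=> Sx Sy; rewrite -scaleN1r; apply/SD/SZ. Qed.

Lemma iter_stable k x : S x -> S (iter k K x).
Proof. by move=> Sx; elim: k => [//|k IH] /=; exact: SK. Qed.

Lemma sum_stable n (f : nat -> V) : (forall k, S (f k)) -> S (\sum_(k < n) f k).
Proof. by move=> Sf; elim/big_ind : _. Qed.

Lemma cesaro_stable n x : S x -> S (cesaro K n x).
Proof. by move=> Sx; apply/SZ/sum_stable => k; exact: iter_stable. Qed.

Lemma iterKD k x y : S x -> S y ->
  iter k K (x + y) = iter k K x + iter k K y.
Proof.
by move=> Sx Sy; elim: k => [//|k IH] /=; rewrite IH KD//; exact: iter_stable.
Qed.

Lemma iterKZ k a x : S x -> iter k K (a *: x) = a *: iter k K x.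
Proof.
by move=> Sx; elim: k => [//|k IH] /=; rewrite IH KZ//; exact: iter_stable.
Qed.

Lemma sum_iterD n x y : S x -> S y -> \sum_(k < n) iter k K (x + y) =
  \sum_(k < n) iter k K x + \sum_(k < n) iter k K y.
Proof.
by move=> Sx Sy; rewrite -big_split/=; under eq_bigr do rewrite iterKD//.
Qed.

Lemma sum_iterZ n a x : S x ->
  \sum_(k < n) iter k K (a *: x) = a *: \sum_(k < n) iter k K x.
Proof.
by move=> Sx; rewrite scaler_sumr; under eq_bigr do rewrite iterKZ//.
Qed.

Lemma cesaroD n x y : S x -> S y ->
  cesaro K n (x + y) = cesaro K n x + cesaro K n y.
Proof. by move=> Sx Sy; rewrite /cesaro sum_iterD// scalerDr. Qed.

Lemma cesaroZ n a x : S x -> cesaro K n (a *: x) = a *: cesaro K n x.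
Proof.
move=> Sx; by rewrite /cesaro sum_iterZ// !scalerA mulrC.
Qed.

(** [q] stands for a squared seminorm. In [q_young] the free weight [t] lets one summand keep a
    constant close to 1 while the other pays [1 + t^-1]; [t = 1] gives the crude bound [q_split]. *)
Hypothesis q_ge0 : forall x, 0 <= q x.
Hypothesis qZ : forall a x, S x -> q (a *: x) = a ^+ 2 * q x.
Hypothesis q_parallelogram : forall x y, S x -> S y ->
  q (x + y) + q (x - y) = 2 * q x + 2 * q y.
Hypothesis q_young : forall (t : R) x y, 0 < t -> S x -> S y ->
  q (x + y) <= (1 + t) * q x + (1 + t^-1) * q y.

(** This is the triangle inequality for sqrt q, without square roots: adding one term to a sum of N
    terms with Young weight 1 / N gives exactly (1 + 1/N) N^2 + (1 + N) = (N + 1)^2. *)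
Lemma q_sum n (f : nat -> V) c : (forall k, S (f k)) -> (forall k, q (f k) <= c) ->
  q (\sum_(k < n) f k) <= n%:R ^+ 2 * c.
Proof.
move=> Sf qf; elim: n => [|[|n] IH].
- rewrite big_ord0 expr0n mul0r -(scale0r 0) qZ//.
  by rewrite expr0n mul0r.
- by rewrite big_ord_recr big_ord0 /= add0r expr1n mul1r.
- rewrite big_ord_recr/=.
  have n0 : (0 : R) < n.+1%:R by rewrite ltr0n.
  have n1 : (0 : R) < n.+1%:R^-1 by rewrite invr_gt0.
  apply: (le_trans (q_young n1 (sum_stable _ Sf) (Sf _))).
  rewrite invrK; have {}IH : (1 + n.+1%:R^-1) * q (\sum_(k < n.+1) f k) <=
      (1 + n.+1%:R^-1) * (n.+1%:R ^+ 2 * c).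
    by rewrite ler_wpM2l// addr_ge0// ltW.
  have Hc : (1 + n.+1%:R) * q (f n.+1) <= (1 + n.+1%:R) * c.
    by rewrite ler_wpM2l// addr_ge0// ltW.
  apply: (le_trans (lerD IH Hc)).
  rewrite le_eqVlt; apply/orP; left; apply/eqP.
  rewrite -[in RHS]natr1; move: (n.+1%:R) n0 => N n0; field.
  exact: lt0r_neq0.
Qed.

Hypothesis qK : forall x, S x -> q (K x) <= q x.

Lemma q_iter k x : S x -> q (iter k K x) <= q x.
Proof.
move=> Sx; elim: k => [//|k IH] /=; apply: le_trans IH.
by apply: qK; exact: iter_stable.
Qed.

Lemma q_cesaro n x : S x -> q (cesaro K n x) <= q x.
Proof.
move=> Sx; rewrite qZ; last by apply: sum_stable => k; exact: iter_stable.
have [->|n0] := eqVneq n 0; first by rewrite invr0 expr0n mul0r.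
have H := q_sum n (fun k => iter_stable k Sx) (fun k => q_iter k Sx).
rewrite exprVn ler_pdivrMl ?exprn_gt0 ?ltr0n ?lt0n//.
Qed.

Lemma q_split x y : S x -> S y -> q (x + y) <= 2 * q x + 2 * q y.
Proof.
move=> Sx Sy; have := q_young ltr01 Sx Sy.
by rewrite invr1 (_ : 1 + 1 = 2 :> R).
Qed.

(* Directions along which the Cesaro means vanish. *)
Let D d := S d /\ exists c, forall n, q (\sum_(k < n) iter k K d) <= c.

Let D0 : D 0.
Proof.
split=> //; exists 0 => n; rewrite big1 => [|k _].
  by rewrite -(scale0r 0) qZ// expr0n mul0r.
by have := iterKZ k 0 S0; rewrite !scale0r.
Qed.

Let DD x y : D x -> D y -> D (x + y).
Proof.
move=> [Sx [a xa]] [Sy [b yb]]; split; first exact: SD.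
exists (2 * a + 2 * b) => n.
rewrite sum_iterD//; apply: (le_trans (q_split _ _)).
- by apply: sum_stable => k; exact: iter_stable.
- by apply: sum_stable => k; exact: iter_stable.
- by rewrite lerD// ler_wpM2l.
Qed.

Let DZ a x : D x -> D (a *: x).
Proof.
move=> [Sx [c xc]]; split; first exact: SZ.
exists (a ^+ 2 * c) => n.
rewrite sum_iterZ// qZ; last by apply: sum_stable => k; exact: iter_stable.
by rewrite ler_wpM2l// sqr_ge0.
Qed.

(** K^k x - x is a sum of coboundaries K y - y. The orbit sums of a coboundary telescope to K^n y -
    y, which stays bounded because K does not increase [q]. *)
Let D_iter k x : S x -> D (iter k K x - x).
Proof.
move=> Sx; elim: k => [|k IH]; first by rewrite subrr.
rewrite [iter _ _ _]iterS (_ : _ - x = K (iter k K x) - iter k K x + (iter k K x - x)).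
  apply: DD IH; set y := iter k K x.
  have Sy : S y by exact: iter_stable.
  split; first by apply: SB => //; exact: SK.
  exists (2 * q y + 2 * q y) => n.
  rewrite (_ : \sum_(_ < n) _ = iter n K y + (-1) *: y); last first.
    elim: n => [|n IH]; first by rewrite big_ord0 /= scaleN1r subrr.
    rewrite big_ord_recr/= IH -scaleN1r iterKD ?iterKZ//; [|exact: SK|exact: SZ].
    by rewrite -iterSr iterS !scaleN1r addrC addrA subrK.
  apply: (le_trans (q_split _ (SZ _ Sy))); first exact: iter_stable.
  rewrite lerD// ler_wpM2l//; first exact: q_iter.
  by rewrite qZ// sqrrN expr1n mul1r.
by rewrite addrA subrK.
Qed.

Let D_cesaro n x : (0 < n)%N -> S x -> D (cesaro K n x - x).
Proof.
move=> n0 Sx; rewrite (_ : _ - x = n%:R^-1 *: \sum_(k < n) (iter k K x - x)).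
  by apply: DZ; elim/big_ind : _ => // k _; exact: D_iter.
have nx : (n%:R^-1 : R) *: (- x *+ n) = - x.
  by rewrite -scalerMnr scalerMnl -mulr_natr mulVf ?scale1r// pnatr_eq0 -lt0n.
by rewrite big_split/= sumr_const card_ord scalerDr nx.
Qed.

(* F. Riesz: all large Cesaro means nearly minimize q over the affine space
   x + D, which contains their midpoints, so they are close to each other by
   the parallelogram law. *)
Theorem cesaro_cauchy x (e : R) : S x -> 0 < e -> exists n0, forall m n,
  (n0 <= m)%N -> (n0 <= n)%N -> q (cesaro K m x - cesaro K n x) <= e.
Proof.
move=> Sx e0; pose A := [set q (x + d) | d in D].
have A0 : A !=set0 by exists (q (x + 0)), 0.
have lbA : lbound A 0 by move=> _ [d _ <-].
have infA : has_inf A by split => //; exists 0.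
pose m0 := inf A.
have m0le d : D d -> m0 <= q (x + d).
  by move=> Dd; apply: ge_inf; [exists 0|exists d].
have [n0 n0P] : exists n0, forall n, (n0 <= n)%N ->
    (0 < n)%N /\ q (cesaro K n x) <= m0 + e / 4.
  (* The budget e / 4 splits into e / 8 for the choice of [d0], e / 16 for the excess [t * a] in
     Young's inequality and e / 16 for the mean of [d0]. The factor 4 produced by the parallelogram
     law at the end turns e / 4 into e. *)
  have e8 : 0 < e / 8 by rewrite divr_gt0.
  have [_ [d0 [Sd0 [c cP]] <-] d0P] := inf_adherent e8 infA.
  set a := q (x + d0) in d0P.
  have a0 : 0 <= a by exact: q_ge0.
  have [t t0 ta] : exists2 t, 0 < t & t * a <= e / 16.
    exists (e / 16 / (a + 1)); first by rewrite !divr_gt0// ltr_wpDl.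
    rewrite mulrAC ler_pdivrMr ?ltr_wpDl//; apply: ler_wpM2l; last by rewrite lerDl.
    by rewrite divr_ge0// ltW.
  have c0 : 0 <= c by rewrite (le_trans (q_ge0 _) (cP 0)).
  pose C := (1 + t^-1) * c.
  have C0 : 0 <= C by rewrite mulr_ge0// addr_ge0// invr_ge0 ltW.
  pose n0 := (Num.truncn (C / (e / 16))).+1.
  exists n0 => n n0n.
  have n_gt0 : (0 < n)%N by exact: leq_trans n0n.
  split => //.
  have nR : (1 : R) <= n%:R by rewrite ler1n.
  have Cn : C <= n%:R * (e / 16).
    rewrite -ler_pdivrMr ?divr_gt0//.
    by apply: (le_trans (ltW (truncnS_gt _))); rewrite ler_nat.
  have Sxd : S (x + d0) by exact: SD.
  (* Moving x along a direction of D changes its n-th mean by O(1/n) in seminorm, so for large n the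
     mean of x does nearly as well as [x + d0]. *)
  have -> : cesaro K n x = cesaro K n (x + d0) + cesaro K n ((-1) *: d0).
    by rewrite -cesaroD//; [rewrite scaleN1r addrK|exact: SZ].
  apply: (le_trans (q_young t0 (cesaro_stable _ Sxd) (cesaro_stable _ (SZ _ Sd0)))).
  have H1 : (1 + t) * q (cesaro K n (x + d0)) <= (1 + t) * a.
    by rewrite ler_wpM2l ?q_cesaro// addr_ge0// ltW.
  have H2 : (1 + t^-1) * q (cesaro K n (-1 *: d0)) <= e / 16.
    rewrite cesaroZ// qZ; last exact: cesaro_stable.
    rewrite sqrrN expr1n mul1r /cesaro qZ; last first.
      by apply: sum_stable => k; exact: iter_stable.
    rewrite mulrCA exprVn ler_pdivrMl ?exprn_gt0 ?ltr0n//.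
    apply: (@le_trans _ _ C).
      by rewrite ler_wpM2l// addr_ge0// invr_ge0 ltW.
    apply: (le_trans Cn); apply: ler_wpM2r; first by rewrite divr_ge0// ltW.
    by rewrite expr2 ler_peMl// (le_trans ler01).
  lra.
exists n0 => m n /n0P[m_gt0 qm] /n0P[n_gt0 qn].
set u := cesaro K m x in qm *; set v := cesaro K n x in qn *.
have Su : S u by exact: cesaro_stable.
have Sv : S v by exact: cesaro_stable.
have half2 : (2 : R)^-1 + 2^-1 = 1 by field.
have mid : D (2^-1 *: (u - x) + 2^-1 *: (v - x)).
  by apply: DD; apply: DZ; exact: D_cesaro.
have := m0le _ mid.
have -> : x + (2^-1 *: (u - x) + 2^-1 *: (v - x)) = 2^-1 *: (u + v).
  rewrite !scalerDr addrACA -scalerDl half2 scale1r.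
  by rewrite [x + _]addrC subrK.
rewrite qZ; last exact: SD.
have := q_parallelogram Su Sv.
rewrite exprVn; lra.
Qed.

End mean_ergodic.

(** * Bounded measurable functions and their integrals *)

Definition bounded_measurable d (T : measurableType d) (R : realType)
    (f : T -> R) :=
  measurable_fun [set: T] f /\ exists M, forall x, `|f x| <= M.

Section bounded_measurable.
Context d (T : measurableType d) (R : realType).
Implicit Types (f g : T -> R) (mu : {finite_measure set T -> \bar R}).
Local Notation bm := (@bounded_measurable _ T R).

Lemma bm_cst (c : R) : bm (fun=> c).
Proof. by split; [exact: measurable_cst|exists `|c|]. Qed.

Lemma bmD f g : bm f -> bm g -> bm (fun x => f x + g x).
Proof.
move=> [mf [a fa]] [mg [b gb]]; split; first exact: measurable_funD.
exists (a + b) => x; apply: (le_trans (ler_normD _ _)); exact: lerD.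
Qed.

Lemma bmM f g : bm f -> bm g -> bm (fun x => f x * g x).
Proof.
move=> [mf [a fa]] [mg [b gb]]; split; first exact: measurable_funM.
by exists (a * b) => x; rewrite normrM ler_pM.
Qed.

Lemma bmZ (c : R) f : bm f -> bm (fun x => c * f x).
Proof. exact/bmM/bm_cst. Qed.

Lemma bmB f g : bm f -> bm g -> bm (fun x => f x - g x).
Proof.
move=> bf bg; under eq_fun do rewrite -mulN1r.
by apply: bmD => //; exact: bmZ.
Qed.

Lemma bm_norm f : bm f -> bm (fun x => `|f x|).
Proof.
move=> [mf [a fa]]; split; first exact: measurableT_comp.
by exists a => x; rewrite normr_id.
Qed.

Lemma bm_sum (I : Type) (s : seq I) (f : I -> T -> R) :
  (forall i, bm (f i)) -> bm (fun x => \sum_(i <- s) f i x).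
Proof.
move=> bf; elim: s => [|i s IH].
  by under eq_fun do rewrite big_nil; exact: bm_cst.
by under eq_fun do rewrite big_cons; exact: bmD.
Qed.

Lemma bm_indic (A : set T) : measurable A -> bm \1_A.
Proof.
move=> mA; split; first exact: measurable_indic.
by exists 1 => x; rewrite indicE; case: (_ \in _); rewrite ?normr0 ?normr1.
Qed.

Lemma bm_integrable mu f : bm f -> mu.-integrable [set: T] (EFin \o f).
Proof.
move=> [mf [M fM]].
apply: (@le_integrable _ _ _ mu _ _ _ (EFin \o cst M)) => //.
- exact/measurable_EFinP.
- by move=> x _ /=; rewrite lee_fin (le_trans (fM x))// ler_norm.
- exact: finite_measure_integrable_cst.
Qed.

Lemma RintegralE mu f : bm f ->
  (\int[mu]_x (f x)%:E)%E = (\int[mu]_x f x)%:E.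
Proof.
move=> bf; rewrite /Rintegral fineK//.
by apply: integrable_fin_num => //; exact: bm_integrable.
Qed.

Lemma bm_RintegralD mu f g : bm f -> bm g ->
  \int[mu]_x (f x + g x) = \int[mu]_x f x + \int[mu]_x g x.
Proof. by move=> bf bg; rewrite RintegralD//; exact: bm_integrable. Qed.

Lemma bm_RintegralB mu f g : bm f -> bm g ->
  \int[mu]_x (f x - g x) = \int[mu]_x f x - \int[mu]_x g x.
Proof. by move=> bf bg; rewrite RintegralB//; exact: bm_integrable. Qed.

Lemma bm_RintegralZ mu (c : R) f : bm f ->
  \int[mu]_x (c * f x) = c * \int[mu]_x f x.
Proof. by move=> bf; rewrite RintegralZl//; exact: bm_integrable. Qed.

Lemma bm_Rintegral_sum mu n (f : nat -> T -> R) : (forall k, bm (f k)) ->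
  \int[mu]_x (\sum_(k < n) f k x) = \sum_(k < n) \int[mu]_x f k x.
Proof.
move=> bf; elim: n => [|n IH].
  rewrite big_ord0; under eq_Rintegral do rewrite big_ord0.
  by rewrite Rintegral_cst// mul0r.
under eq_Rintegral do rewrite big_ord_recr/=.
by rewrite bm_RintegralD// ?IH ?big_ord_recr//; exact: bm_sum.
Qed.

Lemma bm_le_Rintegral mu f g : bm f -> bm g -> (forall x, f x <= g x) ->
  \int[mu]_x f x <= \int[mu]_x g x.
Proof. by move=> bf bg fg; apply: le_Rintegral => //; exact: bm_integrable. Qed.

Lemma bm_normr_Rintegral mu f : bm f ->
  `|\int[mu]_x f x| <= \int[mu]_x `|f x|.
Proof. by move=> bf; apply: le_normr_Rintegral => //; exact: bm_integrable. Qed.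

Lemma Rintegral_indicT mu (A : set T) : measurable A ->
  \int[mu]_x \1_A x = fine (mu A).
Proof. by move=> mA; rewrite /Rintegral integral_indic// setIT. Qed.

Lemma Rintegral_prob_cst (P : probability T R) (c : R) :
  \int[P]_(_ in [set: T]) c = c.
Proof.
by rewrite Rintegral_cst// [X in fine X]probability_setT mulr1.
Qed.

Lemma Rintegral_bounded_cvg0 mu (g : nat -> T -> R) (M : R) :
  (forall n, bm (g n)) -> (forall n x, `|g n x| <= M) ->
  (forall x, g n x @[n --> \oo] --> 0) ->
  \int[mu]_x g n x @[n --> \oo] --> 0.
Proof.
move=> bg gM g0.
have := @dominated_cvg _ T R mu setT measurableT (fun n x => (g n x)%:E)
  (fun=> 0%:E) (EFin \o cst M).
rewrite integral0 => H.
rewrite [X in _ --> X](_ : 0 = fine 0%:E)//.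
apply: fine_cvg; apply: H => //.
- by move=> n; apply/measurable_EFinP; case: (bg n).
- by move=> x _; apply: cvg_EFin; [exact: nearW|exact: g0].
- exact: finite_measure_integrable_cst.
- by move=> n x _; rewrite /= lee_fin.
Qed.

End bounded_measurable.

(** * Daniell representation of positive functionals *)

Section daniell.
Context d (T : measurableType d) (R : realType).
Local Notation bm := (@bounded_measurable _ T R).
Variable Phi : (T -> R) -> R.
Hypothesis PhiD : forall f g, bm f -> bm g ->
  Phi (fun x => f x + g x) = Phi f + Phi g.
Hypothesis PhiZ : forall a f, bm f -> Phi (fun x => a * f x) = a * Phi f.
Hypothesis Phi_ge0 : forall f, bm f -> (forall x, 0 <= f x) -> 0 <= Phi f.
Hypothesis Phi1 : Phi (fun=> 1) = 1.
Hypothesis Phi_cvg0 : forall (g : nat -> T -> R) (M : R),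
  (forall n, bm (g n)) -> (forall n x, `|g n x| <= M) ->
  (forall x, g n x @[n --> \oo] --> 0) -> Phi (g n) @[n --> \oo] --> 0.

Let PhiB f g : bm f -> bm g -> Phi (fun x => f x - g x) = Phi f - Phi g.
Proof.
move=> bf bg; under eq_fun do rewrite -mulN1r.
by rewrite PhiD ?PhiZ ?mulN1r//; exact: bmZ.
Qed.

Let Phi0 : Phi (fun=> 0) = 0.
Proof.
rewrite (_ : (fun=> 0) = (fun _ : T => 0 * 1)); last first.
  by apply/funext => x; rewrite mul0r.
by rewrite PhiZ ?mul0r//; exact: bm_cst.
Qed.

(* The norm only serves to make mu nonnegative on all sets. *)
Let mu (A : set T) : \bar R := (`|Phi \1_A|)%:E.

Let muE A : measurable A -> mu A = (Phi \1_A)%:E.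
Proof.
move=> mA; rewrite /mu ger0_norm// Phi_ge0//; exact: bm_indic.
Qed.

Let mu0 : mu set0 = 0%E.
Proof. by rewrite muE// indic0 Phi0. Qed.

Let mu_ge0 A : (0 <= mu A)%E.
Proof. by rewrite lee_fin. Qed.

Let Phi_bigcup (F : nat -> set T) n : (forall i, measurable (F i)) ->
  trivIset setT F ->
  Phi \1_(\big[setU/set0]_(i < n) F i) = \sum_(i < n) Phi \1_(F i).
Proof.
move=> mF tF; elim: n => [|n IH]; first by rewrite !big_ord0 indic0 Phi0.
rewrite !big_ord_recr/= -IH -PhiD.
- congr Phi; apply/funext => x; rewrite !indicE in_setU.
  have tF' : trivIset (fun i => predT i) F by move=> i j _ _; exact: tF.
  have := trivIset_bigsetUI tF' (isT : predT n) (leqnn n).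
  move=> /seteqP[/(_ x) + _]; rewrite /= => H.
  case: (boolP (x \in F n)) => xn; case: (boolP (_ \in _)) => xN; rewrite ?addr0 ?add0r//.
  by case: H; split; exact: set_mem.
- by apply: bm_indic; exact: bigsetU_measurable.
- exact: bm_indic.
Qed.

Let mu_sigma_additive : semi_sigma_additive mu.
Proof.
move=> F mF tF mU.
have E n : (\sum_(0 <= i < n) mu (F i) =
    (Phi \1_(\big[setU/set0]_(i < n) F i))%:E)%E.
  rewrite Phi_bigcup// big_mkord -sumEFin; apply: eq_bigr => i _.
  by rewrite muE.
rewrite (_ : (fun n => _) = EFin \o (fun n => Phi \1_(\big[setU/set0]_(i < n) F i))); last first.
  by apply/funext => n /=; rewrite E.
rewrite muE//; apply: cvg_EFin; first exact: nearW.
have mn n : measurable (\big[setU/set0]_(i < n) F i) by exact: bigsetU_measurable.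
rewrite -[X in _ --> X]subr0.
(* A partial union is the full union minus a remainder whose indicators are bounded by 1 and, at
   each point, vanish from some n on; [Phi_cvg0] then applies to the remainders. *)
rewrite (_ : (fun n => _) = (fun n => Phi \1_(\bigcup_n F n) -
    Phi (fun x => \1_(\bigcup_n F n) x -
      \1_(\big[setU/set0]_(i < n) F i) x))); last first.
  by apply/funext => n; rewrite PhiB ?subKr//; exact: bm_indic.
apply: cvgB; first exact: cvg_cst.
apply: (@Phi_cvg0 _ 1) => [n|n x|x].
- by apply: bmB; exact: bm_indic.
- rewrite !indicE; case: (_ \in _); case: (_ \in _);
    by rewrite ?subrr ?subr0 ?sub0r ?normrN ?normr0 ?normr1.
- have [[k _ Fkx]|nFx] := pselect ((\bigcup_n F n) x).
  + apply: cvg_near_cst; exists k.+1 => // n /= kn.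
    rewrite !indicE !mem_set ?subrr//; last by exists k.
    by rewrite -bigcup_mkord; exists k.
  + apply: cvg_near_cst; apply: nearW => n.
    rewrite !indicE !memNset ?subrr//.
    by rewrite -bigcup_mkord => -[i /= _ Fi]; apply: nFx; exists i.
Qed.

HB.instance Definition _ :=
  isMeasure.Build d T R mu mu0 mu_ge0 mu_sigma_additive.

Let muT : mu [set: T] = 1%E.
Proof.
rewrite muE// (_ : \1_[set: T] = (fun=> 1)) ?Phi1//.
by apply/funext => x; rewrite indicE in_setT.
Qed.

HB.instance Definition _ := Measure_isProbability.Build d T R mu muT.

Let Q : probability T R := mu.

Import HBNNSimple.

Let Phi_nnsfun (s : {nnsfun T >-> R}) : Phi s = \int[Q]_x s x.
Proof.
have ms y : measurable (s @^-1` [set y]) by exact: measurable_funPTI.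
have bs y : bm (fun x => y * \1_(s @^-1` [set y]) x).
  by apply: bmZ; apply: bm_indic.
have sE : (s : T -> R) = (fun x =>
    \sum_(y <- finmap.enum_fset (fset_set (range s))) y * \1_(s @^-1` [set y]) x).
  by apply/funext => x; rewrite [LHS]fimfunE fsbig_finite.
rewrite [in LHS]sE; transitivity
    (\sum_(y <- finmap.enum_fset (fset_set (range s))) y * Phi \1_(s @^-1` [set y])).
  elim: finmap.enum_fset => [|y r IH].
    by rewrite big_nil; under eq_fun do rewrite big_nil; exact: Phi0.
  rewrite big_cons; under eq_fun do rewrite big_cons.
  rewrite PhiD; [|exact: bs|exact: bm_sum].
  by rewrite IH PhiZ//; exact: bm_indic.
rewrite /Rintegral integralT_nnsfun sintegralE fsbig_finite//=.
rewrite (eq_bigr (fun y => (y * Phi \1_(s @^-1` [set y]))%:E)).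
  by rewrite sumEFin.
by move=> y _; rewrite /Q/= muE.
Qed.

Theorem daniell : exists Q : probability T R,
  forall f, bm f -> Phi f = \int[Q]_x f x.
Proof.
exists Q.
(* Simple functions s_n increase to f with f - s_n between 0 and M. Both functionals tend to 0 on f
   - s_n and agree on s_n, so their difference at f is a constant sequence with limit 0. *)
have pos f : bm f -> (forall x, 0 <= f x) -> Phi f = \int[Q]_x f x.
  move=> bf f0; have [mf [M fM]] := bf.
  have mf' : measurable_fun setT (EFin \o f) by exact/measurable_EFinP.
  pose s n := nnsfun_approx measurableT mf' n.
  have f0' x : setT x -> (0 <= (EFin \o f) x)%E by move=> _; rewrite lee_fin.
  have sf n x : 0 <= s n x <= f x.
    apply/andP; split; first exact: fun_ge0.
    rewrite /s nnsfun_approxE -lee_fin.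
    exact: (@le_approx _ _ _ setT (EFin \o f)).
  have bs n : bm (s n).
    split; first exact: measurable_funPT.
    exists M => x; have /andP[s0 sx] := sf n x.
    by rewrite ger0_norm// (le_trans sx)// (le_trans (ler_norm _)).
  have gs0 x : f x - s n x @[n --> \oo] --> 0.
    rewrite -(subrr (f x)); apply: cvgB; first exact: cvg_cst.
    by have /fine_cvg := cvg_nnsfun_approx measurableT mf' f0' (x := x) I.
  have gM n x : `|f x - s n x| <= M.
    have /andP[s0 sx] := sf n x.
    rewrite ger0_norm ?subr_ge0// (@le_trans _ _ (f x))//.
      by rewrite gerBl.
    by rewrite (le_trans (ler_norm _)).
  have bg n : bm (fun x => f x - s n x) by exact: bmB.
  have H1 := Phi_cvg0 bg gM gs0.
  have H2 := Rintegral_bounded_cvg0 Q bg gM gs0.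
  have H : Phi (fun x => f x - s n x) - \int[Q]_x (f x - s n x)
      @[n --> \oo] --> (0 - 0 : R) by exact: cvgB.
  rewrite subrr (_ : (fun n => _) = (fun=> Phi f - \int[Q]_x f x)) in H; last first.
    apply/funext => n.
    by rewrite PhiB// bm_RintegralB// Phi_nnsfun opprB addrA subrK.
  have := cvg_lim (@Rhausdorff R) H.
  by rewrite lim_cst// => /(_ _)/subr0_eq; apply.
move=> f bf; have [mf [M fM]] := bf.
have bc := bm_cst T M.
have := pos (fun x => f x + M) (bmD bf bc).
rewrite PhiD// bm_RintegralD// -(pos (fun=> M))//.
  move=> H; apply: (addIr _ (H _)) => x.
  by rewrite -lerBlDr sub0r lerNl (le_trans _ (fM x))// -normrN ler_norm.
by move=> x; rewrite (le_trans (normr_ge0 (f x))).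
Qed.

End daniell.

(** * Image laws and Fubini's theorem for bounded functions *)

Section laws.
Context dX (X : measurableType dX) dT (T : measurableType dT) (R : realType).
Local Notation bm := (@bounded_measurable _ _ R).

Lemma bm_comp (psi : X -> T) (f : T -> R) :
  measurable_fun [set: X] psi -> bm f -> bm (fun x => f (psi x)).
Proof.
move=> mpsi [mf [M fM]]; split; first exact: measurableT_comp.
by exists M => x.
Qed.

Lemma Rintegral_law (mu : {finite_measure set X -> \bar R})
    (nu : {measure set T -> \bar R}) (psi : X -> T) (f : T -> R) :
  measurable_fun [set: X] psi ->
  (forall A, measurable A -> nu A = mu (psi @^-1` A)) -> bm f ->
  \int[nu]_x f x = \int[mu]_x f (psi x).
Proof.
move=> mpsi nuE bf; rewrite /Rintegral; congr fine.
rewrite (@eq_measure_integral _ _ _ _ (pushforward mu psi)); last first.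
  by move=> A mA _; rewrite nuE.
have [mf _] := bf.
rewrite integral_pushforward//; first exact/measurable_EFinP.
exact: (bm_integrable mu (bm_comp mpsi bf)).
Qed.

End laws.

Section fubini.
Context dX (X : measurableType dX) dT (T : measurableType dT) (R : realType).
Local Notation bm := (@bounded_measurable _ _ R).
Variables (mu : probability X R) (nu : probability T R) (f : X * T -> R).
Hypothesis bf : bm f.

Let prod : probability (X * T)%type R := (mu \x nu)%E.

Lemma bm_pair x : bm (fun y => f (x, y)).
Proof. exact: bm_comp (pair1_measurable x) bf. Qed.

Lemma bm_fubini : bm (fun x => \int[nu]_y f (x, y)).
Proof.
split.
  (* Fubini's theorem yields measurability of the partial integral relative to some product law; a
     Dirac mass on X supplies one, which keeps the lemma free of any given law on X. *)
  pose dirac_point : probability X R := \d_(point : X).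
  pose prod' : probability (X * T)%type R := (dirac_point \x nu)%E.
  have := measurable_fubini_F (bm_integrable prod' bf).
  exact: measurableT_comp.
have [_ [M fM]] := bf; exists M => x.
apply: (le_trans (bm_normr_Rintegral _ (bm_pair x))).
rewrite -[leRHS](Rintegral_prob_cst nu M); apply: bm_le_Rintegral => //.
- exact/bm_norm/bm_pair.
- exact: bm_cst.
Qed.

Lemma Rintegral_fubini :
  \int[mu]_x \int[nu]_y f (x, y) = \int[prod]_p f p.
Proof.
rewrite /Rintegral -integral12_prod_meas1//; last first.
  exact: (bm_integrable prod bf).
congr fine; apply: eq_integral => x _.
by rewrite /fubini_F/= (RintegralE nu (bm_pair x)).
Qed.

End fubini.

(** * Quantitative absolute continuity *)

Section null_dominates.
Context d (T : measurableType d) (R : realType).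
Local Notation bm := (@bounded_measurable _ _ R).

(** This is the absolute continuity of the integral, applied to the Radon-Nikodym density of
    [nu]. *)
Lemma null_dominates_small (P nu : probability T R) (e : R) : nu `<< P ->
  0 < e -> exists2 r : R, 0 < r & forall A, measurable A ->
    fine (P A) < r -> fine (nu A) <= e.
Proof.
move=> nuP e0.
have [f [f0 ffin intf nuE]] := radon_nikodym_sigma_finite nuP.
have intf' : P.-integrable setT (EFin \o (fine \o f)).
  by apply: eq_integrable intf => // x _ /=; rewrite fineK.
have [r [r0 rP]] := integral_normr_continuous intf' e0.
exists r => // A mA PA; rewrite nuE//.
have PA' : (P A < r%:E)%E by rewrite -[ltLHS]fineK ?fin_num_measure// lte_fin.
have /ltW := rP A mA PA'; rewrite /Rintegral.
by under eq_integral => x _ do rewrite /= ger0_norm ?fine_ge0// fineK//.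
Qed.

(** Markov's inequality makes {|h| >= e / 2} small for P, hence of nu-measure at most (e / 2) / (|C|
    + 1). Off this set |h| < e / 2; on it |h| <= C. Using |C| + 1 avoids any sign condition on C. *)
Lemma null_dominates_sqr_small (P nu : probability T R) (C e : R) :
  nu `<< P -> 0 < e -> exists2 r : R, 0 < r & forall h, bm h ->
    (forall x, `|h x| <= C) -> \int[P]_x (h x ^+ 2) < r ->
    `|\int[nu]_x h x| <= e.
Proof.
move=> nuP e0.
have C1 : 0 < `|C| + 1 by rewrite ltr_wpDl.
have e2 : 0 < e / 2 by rewrite divr_gt0.
have [r r0 rP] := null_dominates_small nuP (divr_gt0 e2 C1).
exists (r * (e / 2) ^+ 2); first by rewrite mulr_gt0// exprn_gt0.
move=> h bh hC hr.
have [mh _] := bh.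
pose A := [set x | e / 2 <= `|h x|].
have mA : measurable A.
  rewrite -[A]setTI; apply: (@measurable_fun_le _ _ _ setT (fun=> e / 2)) => //.
  exact: measurableT_comp.
have bA : bm \1_A by exact: bm_indic.
have PA : fine (P A) < r.
  rewrite -Rintegral_indicT// -(ltr_pM2r (exprn_gt0 2 e2)) (le_lt_trans _ hr)//.
  rewrite mulrC -bm_RintegralZ//; apply: bm_le_Rintegral.
  - exact: bmZ.
  - by under eq_fun do rewrite expr2; exact: bmM.
  - move=> x; rewrite indicE; case: (boolP (x \in A)) => [/set_mem xA|_].
      by rewrite mulr1 -(real_normK (num_real (h x))) lerXn2r// nnegrE// ltW.
    by rewrite mulr0 sqr_ge0.
apply: (le_trans (bm_normr_Rintegral _ bh)).
apply: (@le_trans _ _ (\int[nu]_x (e / 2 + (`|C| + 1) * \1_A x))).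
  apply: bm_le_Rintegral => //; first exact: bm_norm.
    by apply: bmD; [exact: bm_cst|exact: bmZ].
  move=> x; rewrite indicE; case: (boolP (x \in A)) => [_|/negP xA].
    rewrite mulr1 (le_trans (hC x))// (le_trans (ler_norm C))//.
    by rewrite addrCA lerDl addr_ge0// ltW.
  rewrite mulr0 addr0 leNgt; apply/negP => eh; apply: xA.
  by rewrite inE /A /=; exact: ltW.
rewrite bm_RintegralD ?(bm_RintegralZ _ _ bA)//; last 2 first.
- exact: bm_cst.
- exact: bmZ.
rewrite Rintegral_prob_cst Rintegral_indicT// [leRHS](splitr e) lerD2l.
rewrite mulrC -ler_pdivlMr//; exact: rP.
Qed.

End null_dominates.

(** * Transition operator of a random map and the limits of its Cesaro means *)

Section random_map.
Context dT (T : measurableType dT) dE (E : measurableType dE) (R : realType).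
Variables (PE : probability E R) (phi : {mfun (T * E)%type >-> T}).
Local Notation bm := (@bounded_measurable _ T R).

(* One step of the chain z |-> phi (z, e), e ~ PE, acting on functions. *)
Definition transfer (f : T -> R^o) : T -> R^o :=
  fun z => \int[PE]_e f (phi (z, e)).

Definition stationary (nu : probability T R) :=
  forall A, measurable A -> (nu \x PE)%E (phi @^-1` A) = nu A.

Let prodP (nu : probability T R) : probability (T * E)%type R := (nu \x PE)%E.

Let bm_phi (f : T -> R) : bm f -> @bounded_measurable _ _ R (f \o phi).
Proof. by move=> bf; apply: bm_comp. Qed.

Let bm_section f z : bm f -> @bounded_measurable _ _ R (fun e => f (phi (z, e))).
Proof. by move=> bf; exact: bm_pair (bm_phi bf) z. Qed.

Lemma transfer_bounded f M : bm f -> (forall x, `|f x| <= M) ->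
  forall x, `|transfer f x| <= M.
Proof.
move=> bf fM x; apply: (le_trans (bm_normr_Rintegral _ (bm_section x bf))).
rewrite -[leRHS](Rintegral_prob_cst PE M); apply: bm_le_Rintegral => //.
- exact/bm_norm/bm_section.
- exact: bm_cst.
Qed.

Lemma bm_transfer f : bm f -> bm (transfer f).
Proof. by move=> bf; exact: bm_fubini (bm_phi bf). Qed.

Lemma transferD f g : bm f -> bm g ->
  transfer (f + g) = transfer f + transfer g.
Proof.
move=> bf bg; apply/funext => z.
exact: (bm_RintegralD _ (bm_section z bf) (bm_section z bg)).
Qed.

Lemma transferZ (a : R) f : bm f -> transfer (a *: f) = a *: transfer f.
Proof.
by move=> bf; apply/funext => z; exact: (bm_RintegralZ _ _ (bm_section z bf)).
Qed.

Lemma transfer_ge0 f : (forall x, 0 <= f x) -> forall x, 0 <= transfer f x.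
Proof. by move=> f0 x; apply: Rintegral_ge0. Qed.

Lemma transfer1 : transfer (fun=> 1) = (fun=> 1).
Proof. by apply/funext => z; rewrite /transfer Rintegral_prob_cst. Qed.

Lemma Rintegral_transfer (nu : probability T R) f : bm f ->
  \int[nu]_z transfer f z = \int[prodP nu]_p f (phi p).
Proof. by move=> bf; exact: Rintegral_fubini (bm_phi bf). Qed.

Lemma Rintegral_law_transfer (nu nu' : probability T R) f :
  (forall A, measurable A -> nu' A = (nu \x PE)%E (phi @^-1` A)) ->
  bm f -> \int[nu']_z f z = \int[nu]_z transfer f z.
Proof.
by move=> nu'E bf; rewrite Rintegral_transfer//; exact: Rintegral_law.
Qed.

Lemma Rintegral_stationary (nu : probability T R) f : stationary nu -> bm f ->
  \int[nu]_z transfer f z = \int[nu]_z f z.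
Proof.
by move=> nuK bf; symmetry; apply: Rintegral_law_transfer => // A mA; rewrite nuK.
Qed.

(** Over the module [T -> R^o], these are the closure properties that the mean ergodic section asks
    of its set [S]. *)
Let bm0 : bm (0 : T -> R^o). Proof. exact: bm_cst. Qed.
Let bmD' (f g : T -> R^o) : bm f -> bm g -> bm (f + g). Proof. exact: bmD. Qed.
Let bmZ' (a : R) (f : T -> R^o) : bm f -> bm (a *: f). Proof. exact: bmZ. Qed.

Let bm_cesaro n f : bm f -> bm (cesaro transfer n f).
Proof. exact: (cesaro_stable bm0 bmD' bmZ' bm_transfer). Qed.

Let bm_iter n f : bm f -> bm (iter n transfer f).
Proof. exact: (iter_stable bm_transfer). Qed.

Lemma cesaroE n f x :
  cesaro transfer n f x = n%:R^-1 * \sum_(k < n) iter k transfer f x.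
Proof. by rewrite /cesaro fct_sumE. Qed.

Lemma iter_bounded k f M : bm f -> (forall x, `|f x| <= M) ->
  forall x, `|iter k transfer f x| <= M.
Proof.
move=> bf fM; elim: k => [//|k IH] /=.
by apply: transfer_bounded => //; exact: bm_iter.
Qed.

Lemma cesaro_bounded n f M : bm f -> (forall x, `|f x| <= M) ->
  forall x, `|cesaro transfer n f x| <= M.
Proof.
move=> bf fM x; rewrite cesaroE normrM normfV normr_nat.
have [->|n0] := eqVneq n 0.
  by rewrite invr0 mul0r (le_trans _ (fM x)).
rewrite ler_pdivrMl ?ltr0n ?lt0n//.
apply: (le_trans (ler_norm_sum _ _ _)).
apply: (@le_trans _ _ (\sum_(k < n) M)); last by rewrite sumr_const card_ord mulr_natl.
by apply: ler_sum => k _; exact: iter_bounded.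
Qed.

Lemma Rintegral_cesaro (nu : {finite_measure set T -> \bar R}) n f : bm f ->
  \int[nu]_z cesaro transfer n f z =
  n%:R^-1 * \sum_(k < n) \int[nu]_z iter k transfer f z.
Proof.
move=> bf; under eq_Rintegral do rewrite cesaroE.
have bi k : bm (iter k transfer f) by exact: bm_iter.
by rewrite bm_RintegralZ ?(bm_Rintegral_sum _ _ bi)//; exact: bm_sum.
Qed.

Section stationary.
Variable P : probability T R.
Hypothesis PK : stationary P.

Let q (f : T -> R^o) : R := \int[P]_z (f z ^+ 2).

Let bm_sqr (f : T -> R) : bm f -> bm (fun x => f x ^+ 2).
Proof. by move=> bf; under eq_fun do rewrite expr2; exact: bmM. Qed.

Let q_ge0 f : 0 <= q f.
Proof. by apply: Rintegral_ge0 => x _; exact: sqr_ge0. Qed.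

Let qZ (a : R) (f : T -> R^o) : bm f -> q (a *: f) = a ^+ 2 * q f.
Proof.
move=> bf; rewrite /q -bm_RintegralZ//; last exact: bm_sqr.
by apply: eq_Rintegral => x _; rewrite -exprMn.
Qed.

Let q_parallelogram f g : bm f -> bm g ->
  q (f + g) + q (f - g) = 2 * q f + 2 * q g.
Proof.
move=> bf bg.
have bfg : bm (fun x => (f + g) x ^+ 2) by apply: bm_sqr; exact: bmD.
have bfg' : bm (fun x => (f - g) x ^+ 2) by apply: bm_sqr; exact: bmB.
rewrite /q -bm_RintegralD// -!bm_RintegralZ -?bm_RintegralD//.
  apply: eq_Rintegral => x _.
  have -> : (f + g) x = f x + g x by [].
  have -> : (f - g) x = f x - g x by [].
  ring.
- by apply: bmZ; exact: bm_sqr.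
- by apply: bmZ; exact: bm_sqr.
- exact: bm_sqr.
- exact: bm_sqr.
Qed.

Let q_young (t : R) f g : 0 < t -> bm f -> bm g ->
  q (f + g) <= (1 + t) * q f + (1 + t^-1) * q g.
Proof.
move=> t0 bf bg.
have bfg : bm (fun x => (f + g) x ^+ 2) by apply: bm_sqr; exact: bmD.
have bf2 := bm_sqr bf; have bg2 := bm_sqr bg.
rewrite /q -!bm_RintegralZ -?bm_RintegralD//; try exact: bmZ.
apply: bm_le_Rintegral => //; first by apply: bmD; exact: bmZ.
move=> x; have -> : (f + g) x = f x + g x by [].
rewrite -subr_ge0 (_ : _ - _ = (t * f x - g x) ^+ 2 / t).
  by rewrite divr_ge0 ?sqr_ge0// ltW.
by field; exact: lt0r_neq0.
Qed.

(* Jensen's inequality for the kernel, then stationarity. *)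
Let q_transfer f : bm f -> q (transfer f) <= q f.
Proof.
move=> bf; have bf2 := bm_sqr bf.
rewrite /q -(Rintegral_stationary PK bf2).
apply: bm_le_Rintegral; [exact: bm_sqr (bm_transfer bf)|exact: bm_transfer|].
move=> z; set a := transfer f z.
have bs := bm_section z bf; have bs2 := bm_section z bf2.
rewrite -subr_ge0.
have -> : transfer (fun x => f x ^+ 2) z - a ^+ 2 =
    \int[PE]_e ((f (phi (z, e)) - a) ^+ 2).
  have bc c : @bounded_measurable _ E R (fun=> c) by exact: bm_cst.
  transitivity (\int[PE]_e (f (phi (z, e)) ^+ 2 + - 2 * a * f (phi (z, e)) + a ^+ 2)).
    rewrite !bm_RintegralD//; [|exact: bmZ|by apply: bmD => //; exact: bmZ].
    rewrite bm_RintegralZ// Rintegral_prob_cst -[\int[_]_e f _]/(transfer f z) -/a.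
    by rewrite /transfer; ring.
  by apply: eq_Rintegral => e _; ring.
by apply: Rintegral_ge0 => e _; exact: sqr_ge0.
Qed.

Lemma cesaro_transfer_cauchy f e : bm f -> 0 < e ->
  exists n0, forall m n, (n0 <= m)%N -> (n0 <= n)%N ->
  \int[P]_z ((cesaro transfer m f z - cesaro transfer n f z) ^+ 2) <= e.
Proof.
move=> bf e0.
have [n0 n0P] := cesaro_cauchy bm0 bmD' bmZ' bm_transfer transferD transferZ
  q_ge0 qZ q_parallelogram q_young q_transfer bf e0.
by exists n0 => m n m0 n1; exact: n0P.
Qed.

Lemma sqr_cesaro_le n f : bm f ->
  \int[P]_z (cesaro transfer n f z ^+ 2) <= \int[P]_z (f z ^+ 2).
Proof.
exact: (q_cesaro bm0 bmD' bm_transfer q_ge0 qZ q_young q_transfer).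
Qed.

Section limit.
Variable nu : probability T R.
Hypothesis nuP : nu `<< P.

Let L f n := \int[nu]_z cesaro transfer n f z.

Let L_cvg f : bm f -> cvg (L f n @[n --> \oo]).
Proof.
move=> bf; have [_ [M fM]] := bf.
apply: cauchy_cvg; apply: cauchy_exP => e e0.
have e2 : 0 < e / 2 by rewrite divr_gt0.
have [r r0 rP] := null_dominates_sqr_small (2 * M) nuP e2.
have r2 : 0 < r / 2 by rewrite divr_gt0.
have [n0 n0P] := cesaro_transfer_cauchy bf r2.
exists (L f n0); exists n0 => // n /= n0n.
rewrite /ball/= /L -bm_RintegralB; try exact: bm_cesaro.
apply: (@le_lt_trans _ _ (e / 2)); last by rewrite ltr_pdivrMr// mulrDr mulr1 ltrDl.
apply: rP.
- by apply: bmB; exact: bm_cesaro.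
- move=> x; apply: (le_trans (ler_normB _ _)).
  by rewrite mulr_natl mulr2n lerD// cesaro_bounded.
- apply: (@le_lt_trans _ _ (r / 2)); first exact: n0P.
  by rewrite ltr_pdivrMr// mulrDr mulr1 ltrDl.
Qed.

Let Phi f := lim (L f n @[n --> \oo]).

Let L_Phi f : bm f -> L f n @[n --> \oo] --> Phi f.
Proof. exact: L_cvg. Qed.

Let PhiP f l : L f n @[n --> \oo] --> l -> Phi f = l.
Proof. exact: cvg_lim. Qed.

Let PhiD f g : bm f -> bm g -> Phi (fun x => f x + g x) = Phi f + Phi g.
Proof.
move=> bf bg; apply: PhiP.
rewrite (_ : L _ = (fun n => L f n + L g n)); first by apply: cvgD; exact: L_Phi.
apply/funext => n; rewrite /L -bm_RintegralD; try exact: bm_cesaro.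
apply: eq_Rintegral => x _.
by rewrite (cesaroD bm_transfer transferD _ bf bg).
Qed.

Let PhiZ a f : bm f -> Phi (fun x => a * f x) = a * Phi f.
Proof.
move=> bf; apply: PhiP.
rewrite (_ : L _ = (fun n => a * L f n)).
  by apply: cvgM; [exact: cvg_cst|exact: L_Phi].
apply/funext => n; rewrite /L -bm_RintegralZ; last exact: bm_cesaro.
apply: eq_Rintegral => x _.
by rewrite (cesaroZ bm_transfer transferZ _ a bf).
Qed.

Let iter_ge0 f k : (forall x, 0 <= f x) -> forall x, 0 <= iter k transfer f x.
Proof. by move=> f0; elim: k => [//|k IH] /=; exact: transfer_ge0. Qed.

Let Phi_ge0 f : bm f -> (forall x, 0 <= f x) -> 0 <= Phi f.
Proof.
move=> bf f0; apply: limr_ge; first exact: L_cvg.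
apply: nearW => n; apply: Rintegral_ge0 => x _; rewrite cesaroE.
by rewrite mulr_ge0// sumr_ge0// => k _; exact: iter_ge0.
Qed.

Let Phi1 : Phi (fun=> 1) = 1.
Proof.
(* The mean of index 0 is 0, so the sequence is constantly 1 only from n = 1 on. *)
apply: PhiP; apply: cvg_near_cst; exists 1%N => // n /= n0.
rewrite /L; under eq_Rintegral do rewrite cesaroE.
rewrite -[RHS](Rintegral_prob_cst nu 1); apply: eq_Rintegral => x _.
rewrite (eq_bigr (fun=> 1)) ?sumr_const ?card_ord ?mulVf//.
  by rewrite pnatr_eq0 -lt0n.
move=> k _; suff -> : iter k transfer (fun=> 1) = (fun=> 1) by [].
by elim: (nat_of_ord k) => [//|i IH] /=; rewrite IH transfer1.
Qed.

(** Two limits have to be interchanged. By bounded convergence g_n tends to 0 in L^2(P); the Cesaro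
    operators increase neither the L^2(P) seminorm nor the bound M, so the nu-integrals of all means
    of g_n are small uniformly in the index of the mean. *)
Let Phi_cvg0 (g : nat -> T -> R) (M : R) : (forall n, bm (g n)) ->
  (forall n x, `|g n x| <= M) -> (forall x, g n x @[n --> \oo] --> 0) ->
  Phi (g n) @[n --> \oo] --> 0.
Proof.
move=> bg gM g0; apply/cvgr0Pnorm_le => e e0.
have [r r0 rP] := null_dominates_sqr_small M nuP e0.
have : \int[P]_x (g n x ^+ 2) @[n --> \oo] --> 0.
  apply: (@Rintegral_bounded_cvg0 _ _ _ _ _ (M ^+ 2)).
  - by move=> n; exact: bm_sqr.
  - by move=> n x; rewrite normrX lerXn2r// nnegrE// (le_trans _ (gM n x)).
  - by move=> x; under eq_fun do rewrite expr2; rewrite -[0](mulr0 0); exact: cvgM.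
move=> /cvgr0Pnorm_lt /(_ r r0)[n0 _ n0P].
exists n0 => // n /= /n0P; rewrite ger0_norm; last exact: q_ge0.
move=> qr; have H m : `|L (g n) m| <= e.
  apply: rP; first exact: bm_cesaro.
    exact: cesaro_bounded.
  exact: le_lt_trans (sqr_cesaro_le m (bg n)) qr.
rewrite ler_norml; apply/andP; split.
  apply: limr_ge; first exact: L_cvg.
  by apply: nearW => m; have := H m; rewrite ler_norml => /andP[].
apply: limr_le; first exact: L_cvg.
by apply: nearW => m; have := H m; rewrite ler_norml => /andP[].
Qed.

(** The n-th means of K f and of f differ by (K^n f - f) / n, which is at most 2 M / n in absolute
    value. *)
Let Phi_transfer f : bm f -> Phi (transfer f) = Phi f.
Proof.
move=> bf; have [_ [M fM]] := bf.
have bi k : bm (iter k transfer f) by exact: bm_iter.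
have LE n : L (transfer f) n - L f n =
    n%:R^-1 * (\int[nu]_z iter n transfer f z - \int[nu]_z f z).
  rewrite /L !Rintegral_cesaro//; last exact: bm_transfer.
  rewrite -mulrBr -sumrB; congr (_ * _).
  rewrite -(@telescope_sumr _ 0 n (fun k => \int[nu]_z iter k transfer f z))//.
  by rewrite big_mkord; apply: eq_bigr => k _; rewrite -iterSr.
apply: (PhiP (f := transfer f)).
rewrite -[Phi f]addr0 (_ : L _ = (fun n => L f n + (L (transfer f) n - L f n))).
  apply: cvgD; first exact: L_Phi.
  apply/cvgr0Pnorm_le => e e0.
  have [n0 n0P] : exists n0, (2 * M) / e < n0%:R.
    by exists (Num.truncn (2 * M / e)).+1; exact: truncnS_gt.
  exists n0.+1 => // n /= n0n; have n_gt0 : (0 : R) < n%:R by rewrite ltr0n (leq_trans _ n0n).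
  rewrite LE normrM normfV normr_nat ler_pdivrMl//.
  apply: (@le_trans _ _ (2 * M)).
    apply: (le_trans (ler_normB _ _)); rewrite mulr_natl mulr2n.
    have N g : bm g -> (forall x, `|g x| <= M) -> `|\int[nu]_z g z| <= M.
      move=> bg gM; apply: (le_trans (bm_normr_Rintegral _ bg)).
      rewrite -[leRHS](Rintegral_prob_cst nu M).
      by apply: bm_le_Rintegral => //; [exact: bm_norm|exact: bm_cst].
    by rewrite lerD// N//; exact: iter_bounded.
  rewrite -ler_pdivrMr//; apply: (le_trans (ltW n0P)).
  by rewrite ler_nat ltnW.
by apply/funext => n; rewrite addrC subrK.
Qed.

Theorem mean_ergodic_law : exists Q : probability T R, stationary Q /\
  forall f, bm f ->
    \int[nu]_z cesaro transfer n f z @[n --> \oo] --> \int[Q]_z f z.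
Proof.
have [Q PhiQ] := daniell PhiD PhiZ Phi_ge0 Phi1 Phi_cvg0.
exists Q; split => [A mA|f bf]; last by rewrite -PhiQ//; exact: L_Phi.
have bA : bm \1_A by exact: bm_indic.
have mphiA : measurable (phi @^-1` A) by exact: measurable_funPTI.
have H : fine (prodP Q (phi @^-1` A)) = fine (Q A).
  rewrite -(Rintegral_indicT _ mphiA) -(Rintegral_indicT _ mA).
  have := Phi_transfer bA; rewrite !PhiQ//; last exact: bm_transfer.
  by rewrite Rintegral_transfer.
rewrite -[LHS]fineK; last exact: (fin_num_measure (prodP Q)).
by rewrite -[RHS]fineK ?fin_num_measure// -H.
Qed.

End limit.
End stationary.
End random_map.

(** * Extreme invariant laws *)

Lemma weighted_probability d (T : measurableType d) (R : realType)
    (P : probability T R) (h : T -> R) :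
  bounded_measurable h -> (forall x, 0 <= h x) -> 0 < \int[P]_x h x ->
  exists nu : probability T R, nu `<< P /\ forall f, bounded_measurable f ->
    \int[P]_x (h x * f x) = (\int[P]_x h x) * \int[nu]_x f x.
Proof.
move=> bh h0; set l := \int[P]_x h x => l0.
have ln0 : l != 0 by exact: lt0r_neq0.
have [_ [C hC]] := bh.
(* This functional is integration against the density h / l. Daniell's theorem turns it into a
   probability that comes with the integral formula for every bounded function; its continuity
   hypothesis is bounded convergence under P. *)
pose Phi (f : T -> R) := l^-1 * \int[P]_x (h x * f x).
have [|||||nu nuE] := @daniell _ T R Phi.
- move=> f g bf bg; rewrite /Phi -mulrDr; congr (_ * _).
  rewrite -bm_RintegralD; [|exact: bmM|exact: bmM].
  by apply: eq_Rintegral => x _; rewrite mulrDr.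
- move=> a f bf; rewrite /Phi [RHS]mulrCA -(bm_RintegralZ _ a); last exact: bmM.
  by congr (_ * _); apply: eq_Rintegral => x _; rewrite mulrCA.
- move=> f bf f0; rewrite /Phi mulr_ge0 ?invr_ge0 ?(ltW l0)//.
  by apply: Rintegral_ge0 => x _; rewrite mulr_ge0.
- by rewrite /Phi; under eq_Rintegral do rewrite mulr1; rewrite mulVf.
- move=> g M bg gM g0; rewrite -(mulr0 l^-1); apply: cvgM; first exact: cvg_cst.
  apply: (@Rintegral_bounded_cvg0 _ _ _ _ _ (C * M)).
  + by move=> n; exact: bmM.
  + by move=> n x; rewrite normrM ler_pM.
  + by move=> x; rewrite -(mulr0 (h x)); exact: cvgM (cvg_cst _) (g0 x).
have hnu f : bounded_measurable f -> \int[P]_x (h x * f x) = l * \int[nu]_x f x.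
  by move=> bf; rewrite -nuE// /Phi mulVKf.
exists nu; split => //; apply/null_content_dominatesP => A mA PA.
have bA := bm_indic R mA.
rewrite -[LHS]fineK ?fin_num_measure// -(Rintegral_indicT _ mA) -nuE// /Phi.
suff -> : \int[P]_x (h x * \1_A x) = 0 by rewrite mulr0.
apply/eqP; rewrite eq_le; apply/andP; split; last first.
  by apply: Rintegral_ge0 => x _; rewrite mulr_ge0.
apply: (@le_trans _ _ (\int[P]_x (C * \1_A x))).
  apply: bm_le_Rintegral; [exact: bmM|exact: bmZ|move=> x].
  by rewrite ler_wpM2r// (le_trans (ler_norm _)).
by rewrite bm_RintegralZ// Rintegral_indicT// PA mulr0.
Qed.

Section extreme.
Context dT (T : measurableType dT) dE (E : measurableType dE) (R : realType).
Variables (PE : probability E R) (phi : {mfun (T * E)%type >-> T}).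
Local Notation bm := (@bounded_measurable _ T R).
Local Notation K := (transfer PE phi).
Variable P : probability T R.
Hypothesis PK : stationary PE phi P.
Hypothesis P_extreme : forall (P1 P2 : probability T R) (l : R), 0 < l < 1 ->
  stationary PE phi P1 -> stationary PE phi P2 ->
  (forall A, measurable A -> P A = (l%:E * P1 A + (1 - l)%:E * P2 A)%E) ->
  forall A, measurable A -> P1 A = P A /\ P2 A = P A.

Let c (A : set T) n := cesaro K n \1_A.

Let bc A n : measurable A -> bm (c A n).
Proof.
move=> mA; exact: (@cesaro_stable _ _ bm K (bm_cst _ _) (@bmD _ _ _) (@bmZ _ _ _)
  (@bm_transfer _ _ _ _ _ _ _) _ _ (bm_indic R mA)).
Qed.

Let c_bounded A n x : measurable A -> `|c A n x| <= 1.
Proof.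
move=> mA; apply: cesaro_bounded => [|y]; first exact: bm_indic.
by rewrite indicE; case: (_ \in _); rewrite ?normr0 ?normr1.
Qed.

Let P_c A n : measurable A -> (0 < n)%N -> \int[P]_x c A n x = fine (P A).
Proof.
move=> mA n0; have bA := bm_indic R mA; rewrite /c Rintegral_cesaro//.
rewrite (eq_bigr (fun=> fine (P A))) => [|k _].
  by rewrite sumr_const card_ord -(mulr_natl (fine _)) mulKf// pnatr_eq0 -lt0n.
elim: (nat_of_ord k) => [|i IH]; first by rewrite /= Rintegral_indicT.
rewrite iterS Rintegral_stationary//.
exact: (iter_stable (@bm_transfer _ _ _ _ _ PE phi)).
Qed.

(* P is a mixture of the laws with densities h and 1 - h with respect to P; so
   are the limits of their Cesaro means, which must then coincide with P. *)
Lemma cesaro_weak_cvg h A : measurable A -> bm h ->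
  (forall x, 1 / 4 <= h x <= 3 / 4) ->
  \int[P]_x (h x * c A n x) @[n --> \oo] --> (\int[P]_x h x) * fine (P A).
Proof.
move=> mA bh h14; set l := \int[P]_x h x.
have b1 : bm (fun=> 1) by exact: bm_cst.
have bh' : bm (fun x => 1 - h x) by exact: bmB.
have h0 x : 0 <= h x by have := h14 x; lra.
have h'0 x : 0 <= 1 - h x by have := h14 x; lra.
(* The bounds on h keep the masses l and 1 - l of both densities positive: both can be normalized,
   and l is an admissible mixing weight in [P_extreme]. *)
have l14 : 1 / 4 <= l.
  rewrite -[leLHS](Rintegral_prob_cst P); apply: bm_le_Rintegral => //.
    exact: bm_cst.
  by move=> x; have := h14 x; lra.
have l34 : l <= 3 / 4.
  rewrite -[leRHS](Rintegral_prob_cst P); apply: bm_le_Rintegral => //.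
    exact: bm_cst.
  by move=> x; have := h14 x; lra.
have l'E : \int[P]_x (1 - h x) = 1 - l.
  by rewrite bm_RintegralB// Rintegral_prob_cst.
have [|nu1 [nu1P nu1E]] := weighted_probability bh h0 (P := P).
  by rewrite -/l; lra.
have [|nu2 [nu2P nu2E]] := weighted_probability bh' h'0 (P := P).
  by rewrite l'E; lra.
have [Q1 [Q1K Q1E]] := mean_ergodic_law PK nu1P.
have [Q2 [Q2K Q2E]] := mean_ergodic_law PK nu2P.
have cvg1 B : measurable B ->
    \int[P]_x (h x * c B n x) @[n --> \oo] --> l * fine (Q1 B).
  move=> mB; under eq_fun do rewrite (nu1E _ (bc _ mB)).
  apply: cvgM; first exact: cvg_cst.
  by rewrite -(Rintegral_indicT _ mB); apply: Q1E; exact: bm_indic.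
have cvg2 B : measurable B ->
    \int[P]_x ((1 - h x) * c B n x) @[n --> \oo] --> (1 - l) * fine (Q2 B).
  move=> mB; under eq_fun do rewrite (nu2E _ (bc _ mB)) l'E.
  apply: cvgM; first exact: cvg_cst.
  by rewrite -(Rintegral_indicT _ mB); apply: Q2E; exact: bm_indic.
suff <- : fine (Q1 A) = fine (P A) by exact: cvg1.
have l01 : 0 < l < 1 by apply/andP; split; lra.
suff H B : measurable B -> P B = (l%:E * Q1 B + (1 - l)%:E * Q2 B)%E.
  by have [->] := P_extreme l01 Q1K Q2K H mA.
move=> mB; rewrite -[LHS]fineK ?fin_num_measure//.
rewrite -[Q1 B]fineK ?fin_num_measure// -[Q2 B]fineK ?fin_num_measure//.
rewrite -!EFinM -EFinD; congr (_%:E).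
(* The weights h and 1 - h add up to 1, so by invariance the sum of the two sequences is constantly
   P(B) from n = 1 on; uniqueness of limits exhibits P as the mixture of [Q1] and [Q2]. *)
have H : \int[P]_x (h x * c B n x) + \int[P]_x ((1 - h x) * c B n x)
    @[n --> \oo] --> l * fine (Q1 B) + (1 - l) * fine (Q2 B).
  exact: cvgD (cvg1 B mB) (cvg2 B mB).
rewrite -(cvg_lim (@Rhausdorff R) H); apply/esym/cvg_lim => //.
apply: cvg_near_cst; exists 1%N => // n /= n0.
rewrite -(P_c mB n0) -bm_RintegralD; last 2 first.
- by apply: bmM => //; exact: bc.
- by apply: bmM => //; exact: bc.
by apply: eq_Rintegral => x _; rewrite -mulrDl addrC subrK mul1r.
Qed.

(** The range imposed on h is no loss: with a = 4 (C + 1), the function h = u / a + 1 / 2 lies in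
    it. Subtracting the case of the constant 1 / 2 and multiplying by a recovers u. *)
Let cesaro_centered_cvg0 u A : measurable A -> bm u ->
  \int[P]_x (u x * (c A n x - fine (P A))) @[n --> \oo] --> 0.
Proof.
move=> mA bu; have [_ [C uC]] := bu.
set p := fine (P A).
have C0 : 0 <= C by rewrite (le_trans _ (uC point)).
pose a := 4 * (C + 1).
have a0 : 0 < a by rewrite /a; lra.
pose h x := a^-1 * u x + 1 / 2.
have bhalf : bm (fun=> 1 / 2) by exact: bm_cst.
have bh : bm h by apply: bmD => //; exact: bmZ.
have h14 x : 1 / 4 <= h x <= 3 / 4.
  have : `|a^-1 * u x| <= 1 / 4.
    rewrite normrM gtr0_norm ?invr_gt0// ler_pdivrMl// /a.
    by have := uC x; lra.
  by rewrite ler_norml => /andP[]; rewrite /h => *; apply/andP; split; lra.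
have half14 (x : T) : 1 / 4 <= (1 / 2 : R) <= 3 / 4 by apply/andP; split; lra.
have H1 := cesaro_weak_cvg mA bh h14.
have H2 := cesaro_weak_cvg mA bhalf half14.
have H : a * (\int[P]_x (h x * c A n x) - \int[P]_x (1 / 2 * c A n x) -
    (\int[P]_x h x * p - \int[P]_(x in setT) (1 / 2) * p))
    @[n --> \oo] --> a * 0.
  apply: cvgM; first exact: cvg_cst.
  rewrite -(subrr (\int[P]_x h x * p - \int[P]_(x in setT) (1 / 2) * p)).
  by apply: cvgB; [exact: cvgB|exact: cvg_cst].
rewrite mulr0 in H.
rewrite (_ : (fun n => _) = (fun n => a * (\int[P]_x (h x * c A n x) -
    \int[P]_x (1 / 2 * c A n x) -
    (\int[P]_x h x * p - \int[P]_(x in setT) (1 / 2) * p))))//.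
apply/funext => n; have bcn := bc n mA.
have buc : bm (fun x => u x * c A n x) by exact: bmM.
have -> : \int[P]_x (u x * (c A n x - p)) =
    \int[P]_x (u x * c A n x) - p * \int[P]_x u x.
  rewrite -bm_RintegralZ// -bm_RintegralB//; last exact: bmZ.
  by apply: eq_Rintegral => x _; ring.
have -> : \int[P]_x (h x * c A n x) =
    a^-1 * \int[P]_x (u x * c A n x) + \int[P]_x (1 / 2 * c A n x).
  rewrite -bm_RintegralZ// -bm_RintegralD//; [|exact: bmZ|exact: bmM].
  by apply: eq_Rintegral => x _; rewrite /h; ring.
have -> : \int[P]_x h x = a^-1 * \int[P]_x u x + 1 / 2.
  by rewrite bm_RintegralD ?(bm_RintegralZ _ _ bu) ?Rintegral_prob_cst//; exact: bmZ.
by rewrite Rintegral_prob_cst; field; exact: lt0r_neq0.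
Qed.

(* Here [x ^ 2 <= (x - y) ^ 2 + 2 x y], with x and y the centered Cesaro means
   at times m and n: the first term is small because the means are Cauchy in
   L^2(P), the second one because they converge weakly. *)
Let cesaro_centered_sqr A e : measurable A -> 0 < e -> exists n0, forall m,
  (n0 <= m)%N -> \int[P]_x ((c A m x - fine (P A)) ^+ 2) <= e.
Proof.
move=> mA e0; set p := fine (P A); have bA := bm_indic R mA.
have e2 : 0 < e / 2 by rewrite divr_gt0.
have [n0 n0P] := cesaro_transfer_cauchy PK bA e2.
exists n0 => m m0; pose u n x := c A n x - p.
have bu n : bm (u n) by apply: bmB; [exact: bc|exact: bm_cst].
have e4 : 0 < e / 4 by rewrite divr_gt0.
have /cvgr0Pnorm_le /(_ _ e4)[n1 _ n1P] := cesaro_centered_cvg0 mA (bu m).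
(* Here n depends on m: weak convergence is used against the fixed function [u m], while n >= n0
   keeps the Cauchy estimate. The total is e / 2 + 2 (e / 4). *)
pose n := maxn n0 n1.
have bsqr f : bm f -> bm (fun x => f x ^+ 2).
  by move=> bf; under eq_fun do rewrite expr2; exact: bmM.
have b1 : bm (fun x => (c A m x - c A n x) ^+ 2).
  by apply: bsqr; apply: bmB; exact: bc.
have b2 : bm (fun x => u m x * u n x) by exact: bmM.
apply: (@le_trans _ _ (\int[P]_x ((c A m x - c A n x) ^+ 2 + 2 * (u m x * u n x)))).
  apply: bm_le_Rintegral; [exact: bsqr (bu m)|by apply: bmD => //; exact: bmZ|].
  move=> x; rewrite -subr_ge0 /u (_ : _ - _ = (c A n x - p) ^+ 2) ?sqr_ge0//.
  by ring.
rewrite bm_RintegralD//; last exact: bmZ.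
rewrite bm_RintegralZ//.
have := n0P m n m0 (leq_maxl _ _).
have := n1P n (leq_maxr _ _); rewrite /= ler_norml => /andP[_].
by rewrite -/(c A m) -/(c A n) -/(u n _) -/p; lra.
Qed.

Theorem mean_ergodic_extreme (nu Q : probability T R) : nu `<< P ->
  (forall f, bm f ->
    \int[nu]_z cesaro K n f z @[n --> \oo] --> \int[Q]_z f z) ->
  forall A, measurable A -> Q A = P A.
Proof.
move=> nuP QE A mA; have bA := bm_indic R mA.
rewrite -[LHS]fineK ?fin_num_measure// -[RHS]fineK ?fin_num_measure//.
congr (_%:E); rewrite -(Rintegral_indicT _ mA); set p := fine (P A).
rewrite -(cvg_lim (@Rhausdorff R) (QE _ bA)).
apply: cvg_lim => //; apply/cvgrPdist_le => e e0.
have [r r0 rP] := null_dominates_sqr_small 2 nuP e0.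
have r2 : 0 < r / 2 by rewrite divr_gt0.
have [n0 n0P] := cesaro_centered_sqr mA r2.
exists n0 => // n /= n0n.
have b1 : bm (fun=> p) by exact: bm_cst.
have bu : bm (fun x => c A n x - p) by apply: bmB => //; exact: bc.
rewrite distrC -[in X in `|_ - X|](Rintegral_prob_cst nu p) -bm_RintegralB//.
  apply: rP => //.
    move=> x; apply: (le_trans (ler_normB _ _)).
    rewrite -[2]/(1 + 1) lerD// ?c_bounded//.
    rewrite ger0_norm ?fine_ge0// -lee_fin /p fineK ?fin_num_measure//.
    exact: probability_le1.
  apply: (le_lt_trans (n0P _ n0n)).
  by rewrite ltr_pdivrMr// mulrDr mulr1 ltrDl.
exact: bc.
Qed.

End extreme.

(** * Second countability and Borel sets of products *)

Lemma separable_second_countable (R : realType) (T : pseudoPMetricType R) :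
  separable T -> @second_countable T.
Proof.
move=> [D cD dD].
have npos n : (0 : R) < n.+1%:R^-1 by [].
(* Balls need not be open, hence the interiors; centers in [D] and radii 1 / (n + 1) leave countably
   many of them. *)
exists (\bigcup_n [set (ball z n.+1%:R^-1)° | z in D]).
  by apply: bigcup_countable => // n _; exact: sub_countable (card_image_le _ _) cD.
split=> [_ [n _ [z _ <-]]|x V /nbhs_ballP[_/posnumP[eps] xV]].
  exact: open_interior.
have [//|n] := @ltr_add_invr R 0 (eps%:num / 2) _; rewrite add0r => neps.
(* With z in [D] within half a radius of x, the ball of the other half radius around x fits into the
   ball around z, so x is interior to it. *)
have n2 : (0 : R) < n.+1%:R^-1 / 2 by rewrite divr_gt0.
have [|z [zx Dz]] := dD (ball x (n.+1%:R^-1 / 2))° _ (open_interior _).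
  by exists x; exact: nbhsx_ballx.
have {}zx : ball z (n.+1%:R^-1 / 2) x by apply/ball_sym; exact: interior_subset zx.
exists (ball z n.+1%:R^-1)°.
  split; first by exists n => //; exists z.
  rewrite /interior; apply: filterS (nbhsx_ballx x _ n2) => y xy.
  by rewrite [_^-1]splitr; exact: ball_triangle zx xy.
move=> y /interior_subset zy; apply: xV; rewrite [_%:num]splitr.
apply: (@ball_triangle _ _ z); last exact: le_ball (ltW neps) _ zy.
apply/ball_sym; apply: le_ball zx; apply: le_trans (ltW neps).
by rewrite ler_pdivrMr// ler_peMr// ?ler1n.
Qed.

(** Second countability makes an open set of the product a countable union of open rectangles;
    without it, the Borel sets of a product may exceed the product sigma-algebra. *)
Lemma measurable_open_prod (T1 T2 : ptopologicalType) (O : set (T1 * T2)) :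
  @second_countable T1 -> @second_countable T2 -> open O ->
  measurable (O : set (borel T1 * borel T2)%type).
Proof.
move=> [B1 cB1 [oB1 nB1]] [B2 cB2 [oB2 nB2]] oO.
pose I := [set b : set T1 * set T2 | [/\ B1 b.1, B2 b.2 & b.1 `*` b.2 `<=` O]].
have cI : countable I.
  apply: (@sub_countable _ _ _ (B1 `*` B2)); last exact: countableX.
  by apply: subset_card_le => -[a b] [].
have -> : O = \bigcup_(b in I) (b.1 `*` b.2).
  apply/seteqP; split=> [[x y] Oxy|xy [b [_ _ bO] bxy]]; last exact: bO.
  have [[P1 P2] /= [xP1 yP2] PO] : nbhs (x, y) O by exact: open_nbhs_nbhs.
  have [b1 [Bb1 b1x] bP1] := nB1 x _ xP1.
  have [b2 [Bb2 b2y] bP2] := nB2 y _ yP2.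
  exists (b1, b2) => //; split => //= -[u v] [/= b1u b2v].
  by apply: PO; split; [exact: bP1|exact: bP2].
have mI b : I b -> measurable (b.1 `*` b.2 : set (borel T1 * borel T2)%type).
  move=> [Bb1 Bb2 _]; apply: measurableX; apply: sub_sigma_algebra.
    exact: oB1.
  exact: oB2.
have /pfcard_geP[->|[f]] := cI; first by rewrite bigcup_set0.
rewrite -[I](image_eq f) bigcup_image.
by apply: bigcupT_measurable => n; apply: mI; exact: funS.
Qed.

Lemma measurable_continuous_prod (R : realType) (T1 T2 : ptopologicalType)
    (c : T1 * T2 -> R) :
  @second_countable T1 -> @second_countable T2 -> continuous c ->
  measurable_fun [set: borel T1 * borel T2] (c : (borel T1 * borel T2)%type -> R).
Proof.
move=> T1c T2c cc.
apply: (measurability _ (RGenOpens.measurableE R)) => _ [_ [a [b ->]] <-].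
rewrite setTI; apply: measurable_open_prod => //.
by move/continuousP: cc; apply; exact: interval_open.
Qed.

(** * Measurability of histories, products of laws and independence *)

Section past.
Context d (T : measurableType d) d' (D : measurableType d').

Lemma measurable_past (f : D -> past T) :
  (forall n, measurable_fun [set: D] (fun x => f x n)) ->
  measurable_fun [set: D] f.
Proof.
move=> mf; apply: (@measurability _ _ D (past T) setT f (@coordinate_sets _ T)) => //.
move=> _ [_ [n _ [A mA <-]] <-]; rewrite setTI setTI.
have := mf n measurableT _ mA; by rewrite setTI.
Qed.

Lemma measurable_coordinate n : measurable_fun [set: past T] (fun y => y n).
Proof.
move=> _ A mA; rewrite setTI; apply: sub_sigma_algebra.
by exists n => //; exists A => //; rewrite setTI.
Qed.

Lemma measurable_append (a : D -> T) (y : D -> past T) :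
  measurable_fun [set: D] a -> measurable_fun [set: D] y ->
  measurable_fun [set: D] (fun x => append (a x) (y x) : past T).
Proof.
move=> ma my; apply: measurable_past => -[//|n] /=.
exact: measurableT_comp (measurable_coordinate n) my.
Qed.

End past.

(** Invariance is phrased with a left-nested product of four laws, whereas a random map takes all
    its noise as one variable. Tonelli's theorem, peeling off one factor at a time, reduces both
    sides to the same iterated integral. *)
Lemma product_measureA dS (S : measurableType dS) dN (N : measurableType dN)
    dW (W : measurableType dW) dV (V : measurableType dV) (R : realType)
    (nu : probability S R) (PN : probability N R) (PW : probability W R)
    (PV : probability V R) (B : set (S * N * W * V)) : measurable B ->
  (nu \x PN \x PW \x PV)%E B =
  (nu \x (PN \x PW \x PV))%E
    [set p | B (p.1, p.2.1.1, p.2.1.2, p.2.2)].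
Proof.
move=> mB; set B' := [set p | _].
pose h (p : S * (N * W * V)) := (p.1, p.2.1.1, p.2.1.2, p.2.2).
have mh : measurable_fun setT h.
  apply: measurable_fun_pair; [apply: measurable_fun_pair; [apply: measurable_fun_pair|]|].
  - exact: measurable_fst.
  - by apply: measurableT_comp => //; apply: measurableT_comp => //.
  - by apply: measurableT_comp => //; apply: measurableT_comp => //.
  - by apply: measurableT_comp.
have mB' : measurable B' by rewrite -[B']setTI; exact: mh.
pose f (p : S * N * W * V) : \bar R := (\1_B p)%:E.
have f0 p : (0 <= f p)%E by rewrite lee_fin.
have mf : measurable_fun setT f by apply/measurable_EFinP; exact: measurable_indic.
pose m1 : probability (S * N * W * V)%type R := (nu \x PN \x PW \x PV)%E.
pose m2 : probability (S * (N * W * V))%type R := (nu \x (PN \x PW \x PV))%E.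
transitivity (\int[m1]_p f p)%E; first by rewrite integral_indic// setIT.
have m2E : (\int[m2]_p (\1_B' p)%:E = m2 B')%E.
  rewrite integral_indic; [|exact: measurableT|exact: mB'].
  by rewrite setIT.
transitivity (\int[m2]_p f (h p))%E; last exact: m2E.
have mfh : measurable_fun setT (f \o h) by exact: measurableT_comp.
pose m1' : probability (S * N * W)%type R := (nu \x PN \x PW)%E.
pose m1'' : probability (S * N)%type R := (nu \x PN)%E.
pose m2' : probability (N * W * V)%type R := (PN \x PW \x PV)%E.
pose m2'' : probability (N * W)%type R := (PN \x PW)%E.
pose f1 q := (\int[PV]_v f (q, v))%E.
have mf1 : measurable_fun setT f1 by exact: (measurable_fun_fubini_tonelli_F f mf f0 (m2 := PV)).
have f1_ge0 q : (0 <= f1 q)%E by exact: integral_ge0.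
pose f2 q := (\int[PW]_w f1 (q, w))%E.
have mf2 : measurable_fun setT f2 by exact: (measurable_fun_fubini_tonelli_F f1 mf1 f1_ge0 (m2 := PW)).
have f2_ge0 q : (0 <= f2 q)%E by exact: integral_ge0.
have -> : (\int[m1]_p f p = \int[m1']_q f1 q)%E by exact: (fubini_tonelli1 f mf f0 (m1 := m1') (m2 := PV)).
have -> : (\int[m1']_q f1 q = \int[m1'']_q f2 q)%E by exact: (fubini_tonelli1 f1 mf1 f1_ge0 (m1 := m1'') (m2 := PW)).
have -> : (\int[m1'']_q f2 q = \int[nu]_s \int[PN]_n f2 (s, n))%E.
  exact: (fubini_tonelli1 f2 mf2 f2_ge0 (m1 := nu) (m2 := PN)).
have -> : (\int[m2]_p f (h p) = \int[nu]_s \int[m2']_e f (h (s, e)))%E.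
  exact: (fubini_tonelli1 (f \o h) mfh (fun=> f0 _) (m1 := nu) (m2 := m2')).
apply: eq_integral => s _; symmetry.
have mfs : measurable_fun setT (fun e => f (h (s, e))).
  exact: measurable_fun_pair2 mfh.
have -> : (\int[m2']_e f (h (s, e)) = \int[m2'']_q \int[PV]_v f (h (s, (q, v))))%E.
  exact: (fubini_tonelli1 _ mfs (fun=> f0 _) (m1 := m2'') (m2 := PV)).
pose g1 q := (\int[PV]_v f (h (s, (q, v))))%E.
have mg1 : measurable_fun setT g1 by exact: (measurable_fun_fubini_tonelli_F _ mfs (fun=> f0 _) (m2 := PV)).
have g1_ge0 q : (0 <= g1 q)%E by exact: integral_ge0.
exact: (fubini_tonelli1 g1 mg1 g1_ge0 (m1 := PN) (m2 := PW)).
Qed.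

(** The law of (X, Z) under P conditioned on F agrees with the product on rectangles, hence
    everywhere by uniqueness of product measures. Conditioning requires P F to be nonzero, so the
    null case is treated apart. *)
Lemma independent_pair dO (Omega : measurableType dO) dT (T : measurableType dT)
    dN (N : measurableType dN) (R : realType) (P : probability Omega R)
    (X : Omega -> T) (Z : Omega -> N) (mX : probability T R)
    (mZ : probability N R) (F : set Omega) :
  measurable F -> measurable_fun [set: Omega] X -> measurable_fun [set: Omega] Z ->
  (forall A B, measurable A -> measurable B ->
    P (X @^-1` A `&` (Z @^-1` B `&` F)) = (mX A * (mZ B * P F))%E) ->
  forall D, measurable D ->
    P ((fun om => (X om, Z om)) @^-1` D `&` F) = ((mX \x mZ) D * P F)%E.
Proof.
move=> mF mmX mmZ H D mD.
pose XZ om := (X om, Z om).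
have mXZ : measurable_fun setT XZ by exact: measurable_fun_pair.
have [PF0|PF0] := eqVneq (P F) 0%E.
  rewrite PF0 mule0; apply: (subset_measure0 _ mF _ PF0); last exact: subIsetr.
  by apply: measurableI => //; rewrite -[_ @^-1` _]setTI; exact: mXZ.
have PFfin : P F \is a fin_num by exact: fin_num_measure.
have PFE : P F = (fine (P F))%:E by rewrite fineK.
have PF_gt0 : 0 < fine (P F).
  by rewrite fine_gt0// lt0e PF0 measure_ge0/= ltey_eq PFfin.
have c0 : 0 <= (fine (P F))^-1 by rewrite invr_ge0 ltW.
pose m0' : {measure set (T * N) -> \bar R} :=
  mscale (NngNum c0) (pushforward (mrestr P mF) XZ).
pose m0 := m0' mXZ.
have m0E D' : m0 D' = ((fine (P F))^-1%:E * P (XZ @^-1` D' `&` F))%E by [].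
rewrite (@product_measure_unique _ _ _ _ _ mX mZ m0)//.
  rewrite m0E -/XZ [in RHS]PFE muleAC -EFinM mulVf ?mul1e//.
  by rewrite gt_eqF.
move=> A B mA mB; rewrite m0E.
have -> : XZ @^-1` (A `*` B) `&` F = X @^-1` A `&` (Z @^-1` B `&` F).
  by rewrite setIA.
have PFV : ((fine (P F))^-1%:E * P F = 1)%E.
  by rewrite -[X in (_ * X)%E]fineK// -EFinM mulVf// gt_eqF.
rewrite H// (_ : mX A * (mZ B * P F) = P F * (mX A * mZ B))%E.
  by rewrite muleA PFV mul1e.
by rewrite muleA muleC.
Qed.

Section independence.
Context dO (Omega : measurableType dO) (R : realType) (P : probability Omega R).
Context (I : choiceType) (H : I -> set (set Omega)).

(** C collects the sources of noise not consumed so far. The product formula asserts at once that X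
    has law m, that X is independent of these sources, and that they are independent of each
    other. *)
Definition law_independent dT (T : measurableType dT) (X : Omega -> T)
    (m : probability T R) (C : {pred I}) :=
  forall (A : set T) (s : seq I) (E : I -> set Omega),
    measurable A -> uniq s -> {subset s <= C} -> (forall i, i \in s -> H i (E i)) ->
    P (X @^-1` A `&` \bigcap_(i in [set` s]) E i) =
    (m A * \prod_(i <- s) P (E i))%E.

Lemma law_independentE dT (T : measurableType dT) (X : Omega -> T)
    (m : probability T R) (C : {pred I}) : law_independent X m C ->
  forall A, measurable A -> P (X @^-1` A) = m A.
Proof.
move=> XC A mA; have := XC A [::] (fun=> setT) mA isT.
rewrite big_nil mule1 => <- //; congr (P _).
by apply/seteqP; split => [om ?|om []].
Qed.

(** Consumption of one source: the noise generating [H i0] joins the variable, and [i0] leaves the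
    set of available indices. *)
Lemma law_independent_pair dT (T : measurableType dT) dN (N : measurableType dN)
    (X : Omega -> T) (Z : Omega -> N) (m : probability T R) (mZ : probability N R)
    (C C' : {pred I}) (i0 : I) :
  measurable_fun [set: Omega] X -> measurable_fun [set: Omega] Z ->
  (forall i, H i `<=` measurable) -> H i0 = sigma_of Z ->
  (forall B, measurable B -> P (Z @^-1` B) = mZ B) ->
  i0 \in C -> i0 \notin C' -> {subset C' <= C} ->
  law_independent X m C ->
  law_independent (fun om => (X om, Z om)) (m \x mZ)%E C'.
Proof.
move=> mX mmZ mH Hi0 PZ i0C i0C' C'C XC D s E mD us sC' HE.
set F := \bigcap_(i in _) _.
have mF : measurable F.
  by rewrite /F bigcap_seq big_seq; apply: bigsetI_measurable => i /HE; exact: mH.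
have sC : {subset s <= C} by move=> i /sC'/C'C.
have PF : P F = (\prod_(i <- s) P (E i))%E.
  by have := XC setT s E measurableT us sC HE; rewrite preimage_setT setTI probability_setT mul1e.
rewrite -PF; apply: (independent_pair mF mX mmZ) => // A B mA mB.
have i0s : i0 \notin s by apply/negP => /sC'; exact/negP.
pose E' i := if i == i0 then Z @^-1` B else E i.
have E's i : i \in s -> E' i = E i.
  by move=> si; rewrite /E'; case: eqP => // ii0; rewrite -ii0 si in i0s.
have := XC A (i0 :: s) E' mA _ _ _; rewrite big_cons.
rewrite (eq_big_seq (fun i => P (E i))); last by move=> i /E's ->.
rewrite -PF [E' i0]/E' eqxx PZ//.
have -> : \bigcap_(i in [set` i0 :: s]) E' i = Z @^-1` B `&` F.
  by rewrite /F !bigcap_seq big_cons (eq_big_seq E)// {1}/E' eqxx.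
apply.
- by rewrite /= i0s.
- by move=> i; rewrite inE => /predU1P[->//|/sC].
- move=> i; rewrite inE => /predU1P[->|si]; last by rewrite E's//; exact: HE.
  by rewrite /E' eqxx Hi0; exists B => //; rewrite setTI.
Qed.

End independence.

(** * The controlled model and the laws of its states *)

Section model.
Context (R : realType) (X Y : completeMetricType R) (U : pmetricType R).
Context (dW dV : measure_display) (W : measurableType dW) (V : measurableType dV).
Context (PW : probability W R) (PV : probability V R).
Context (F : {mfun (borel X * borel U * W)%type >-> borel X}).
Context (G : {mfun (borel X * V)%type >-> borel Y}).
Context dN (N : measurableType dN) (PN : probability N R).
Context (gamma : {mfun (history Y U * N)%type >-> borel U}).
Local Notation state := (state X Y U).
Local Notation noise := (N * W * V)%type.

Lemma measurable_next_state d (T : measurableType d) (z : T -> state)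
    (u : T -> borel U) (w : T -> W) (v : T -> V) :
  measurable_fun [set: T] z -> measurable_fun [set: T] u ->
  measurable_fun [set: T] w -> measurable_fun [set: T] v ->
  measurable_fun [set: T] (fun x => next_state F G (z x) (u x) (w x) (v x)).
Proof.
move=> mz mu mw mv.
have mx : measurable_fun setT (fun x => F ((z x).2, u x, w x)).
  apply: measurableT_comp => //; apply: measurable_fun_pair => //.
  by apply: measurable_fun_pair => //; exact: measurableT_comp.
apply: measurable_fun_pair => //=; apply: measurable_fun_pair => /=.
  apply: measurable_append.
    by apply: measurableT_comp => //; exact: measurable_fun_pair.
  by apply: measurableT_comp => //; exact: measurableT_comp.
by apply: measurable_append => //; apply: measurableT_comp => //; exact: measurableT_comp.
Qed.

(** The noises R, W and V of one step are grouped into a single variable, which makes the step a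
    random map in the sense of [transfer]. *)
Definition policy_step (p : state * noise) : state :=
  next_state F G p.1 (gamma (p.1.1, p.2.1.1)) p.2.1.2 p.2.2.

Let measurable_policy_step : measurable_fun [set: (state * noise)%type] policy_step.
Proof.
apply: measurable_next_state => //.
- apply: measurableT_comp => //; apply: measurable_fun_pair.
    exact: measurableT_comp.
  by apply: measurableT_comp => //; exact: measurableT_comp.
- by apply: measurableT_comp => //; exact: measurableT_comp.
- exact: measurableT_comp.
Qed.

HB.instance Definition _ :=
  isMeasurableFun.Build _ _ _ _ policy_step measurable_policy_step.

Let PE : probability noise R := (PN \x PW \x PV)%E.

Local Notation K := (transfer PE policy_step).

Let measurable_flat_step : measurable_fun [set: (state * N * W * V)%type]
  (fun p => next_state F G p.1.1.1 (gamma (p.1.1.1.1, p.1.1.2)) p.1.2 p.2).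
Proof.
apply: measurable_next_state => //.
- by apply: measurableT_comp => //; exact: measurableT_comp.
- apply: measurableT_comp => //; apply: measurable_fun_pair.
    by do 3 apply: measurableT_comp => //.
  by apply: measurableT_comp => //; exact: measurableT_comp.
- exact: measurableT_comp.
Qed.

Lemma policy_stepE (nu : probability state R) A : measurable A ->
  (nu \x PN \x PW \x PV)%E [set p | A (next_state F G p.1.1.1
     (gamma (p.1.1.1.1, p.1.1.2)) p.1.2 p.2)] =
  (nu \x PE)%E (policy_step @^-1` A).
Proof.
move=> mA; rewrite product_measureA//.
by rewrite -[X in measurable X]setTI; exact: measurable_flat_step.
Qed.

Lemma invariant_stationary (nu : probability state R) :
  invariant_measure PW PV F G PN gamma nu <-> stationary PE policy_step nu.
Proof.
split=> H A mA; have := H A mA; first by rewrite -policy_stepE.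
by rewrite -policy_stepE.
Qed.

Section process.
Context dO (Omega : measurableType dO) (P : probability Omega R).
Variable p : process X Y U W V Omega N.
Hypothesis p_controlled : controlled_from PW PV F G 0 P PN (fun=> gamma) p.

Lemma measurable_history_at t : measurable_fun [set: Omega] (history_at p t).
Proof.
by apply: measurable_fun_pair; apply: measurable_past => n /=; exact: measurable_funPT.
Qed.

Lemma measurable_state_at t : measurable_fun [set: Omega] (state_at p t).
Proof.
by apply: measurable_fun_pair => //; exact: measurable_history_at.
Qed.

HB.instance Definition _ t :=
  isMeasurableFun.Build _ _ _ _ (state_at p t) (measurable_state_at t).

Lemma state_at_step (k : nat) om : state_at p k.+1%:Z om =
  next_state F G (state_at p k%:Z om)
    (gamma (history_at p k%:Z om, rnoise p k%:Z om))
    (wnoise p k%:Z om) (vnoise p k.+1%:Z om).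
Proof.
have [/(_ k%:Z om isT)[actE stE obsE] _ _] := p_controlled.
have k1 : k%:Z + 1 = k.+1%:Z by rewrite -addn1 PoszD.
rewrite /state_at /next_state/=.
rewrite k1 in stE obsE.
rewrite -actE -stE -obsE; congr (_, _).
rewrite /history_at; congr (_, _); apply/funext => -[|n] /=.
- by rewrite subr0.
- by congr (obs p _ om); rewrite -k1 -[n.+1]addn1 PoszD; ring.
- by congr (act p _ om); rewrite -k1; ring.
- by congr (act p _ om); rewrite -k1 -[n.+1]addn1 PoszD; ring.
Qed.

Let I := (nat + nat + nat)%type.
Let H (i : I) := innovation p 0 (Some i).
(** This is the step at which a source is consumed. The source [inl (inr n)] is V_(n+1), used
    together with R_n and W_n in passing from Z_n to Z_(n+1); hence its time is n. *)
Let time (i : I) : nat :=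
  match i with inl (inl n) => n | inl (inr n) => n | inr n => n end.

Let H_measurable i : H i `<=` measurable.
Proof.
by case: i => [[n|n]|n] _ [A mA <-]; apply: measurable_funPT.
Qed.

Variable nu0 : probability state R.
Hypothesis p_init : forall A, measurable A -> P (state_at p 0 @^-1` A) = nu0 A.

Let state_independent0 : law_independent P H (state_at p 0) nu0 predT.
Proof.
move=> A s E mA us _ HE.
have [_ _ /(_ (None :: map Some s))] := p_controlled.
move=> /(_ (fun i => if i is Some i then E i else state_at p 0 @^-1` A)).
rewrite !bigcap_seq !big_cons !big_map p_init//; apply.
  by rewrite /= map_inj_uniq// us andbT; apply/mapP => -[].
move=> i; rewrite inE => /predU1P[->|/mapP[j js ->]]; last exact: HE.
by exists A => //; rewrite setTI.
Qed.

(** Adding R_k is kept apart from the other noises because the cost at time k is a function of Z_k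
    and R_k. *)
Let noise_pair k (nu : probability state R) : law_independent P H (state_at p k%:Z) nu [pred i | k <= time i]%N ->
  law_independent P H (fun om => (state_at p k%:Z om, rnoise p k%:Z om))
    (nu \x PN)%E [pred i | (k <= time i)%N && (i != inr k)].
Proof.
move=> Hk; apply: (law_independent_pair (i0 := inr k) _ _ H_measurable _ _ _ _ _ Hk).
- exact: measurable_state_at.
- exact: measurable_funPT.
- by rewrite /H /= add0r.
- by have [_ /(_ k%:Z isT)[]] := p_controlled.
- by rewrite inE /=.
- by rewrite inE /= eqxx andbF.
- by move=> i; rewrite !inE => /andP[].
Qed.

Let state_step k (nu nu' : probability state R) :
  law_independent P H (state_at p k%:Z) nu [pred i | k <= time i]%N ->
  (forall A, measurable A -> nu' A = (nu \x PE)%E (policy_step @^-1` A)) ->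
  law_independent P H (state_at p k.+1%:Z) nu' [pred i | k < time i]%N.
Proof.
move=> /noise_pair Hk nu'E.
have mZ0 : measurable_fun setT (fun om => (state_at p k om, rnoise p k om)).
  by apply: measurable_fun_pair => //; exact: measurable_state_at.
have {}Hk : law_independent P H
    (fun om => (state_at p k%:Z om, rnoise p k%:Z om, wnoise p k%:Z om))
    (nu \x PN \x PW)%E
    [pred i | [&& (k <= time i)%N, i != inr k & i != inl (inl k)]].
  apply: (law_independent_pair (i0 := inl (inl k)) mZ0 _ H_measurable _ _ _ _ _ Hk).
  - exact: measurable_funPT.
  - by rewrite /H /= add0r.
  - by have [_ /(_ k%:Z isT)[]] := p_controlled.
  - by rewrite inE /= leqnn.
  - by rewrite inE /= eqxx !andbF.
  - by move=> i; rewrite !inE => /and3P[-> ->].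
have {}Hk : law_independent P H
    (fun om => (state_at p k%:Z om, rnoise p k%:Z om, wnoise p k%:Z om,
       vnoise p k.+1%:Z om))
    (nu \x PN \x PW \x PV)%E [pred i | k < time i]%N.
  apply: (law_independent_pair (i0 := inl (inr k)) _ _ H_measurable _ _ _ _ _ Hk).
  - exact: measurable_fun_pair.
  - exact: measurable_funPT.
  - by rewrite /H /= add0r.
  - have [_ /(_ k%:Z isT)[_ + _] _] := p_controlled.
    by rewrite (_ : k%:Z + 1 = k.+1%:Z)// -addn1 PoszD.
  - by rewrite inE /= leqnn.
  - by rewrite inE /= ltnn.
  - move=> i; rewrite !inE => ki; rewrite (ltnW ki) /=.
    by apply/andP; split; apply: contraTN ki => /eqP ->; rewrite /= ltnn.
move=> A s E mA us sC HE.
pose D := [set q : state * N * W * V | A (next_state F G q.1.1.1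
     (gamma (q.1.1.1.1, q.1.1.2)) q.1.2 q.2)].
have mD : measurable D by rewrite -[D]setTI; exact: measurable_flat_step.
have -> : nu' A = (nu \x PN \x PW \x PV)%E D.
  by rewrite nu'E//; exact/esym/policy_stepE.
rewrite -(Hk D s E mD us sC HE).
congr (P (_ `&` _)); apply/funext => om.
by rewrite /preimage/= state_at_step.
Qed.

(** Independence from the noises still to come is part of the induction, since the next step draws
    on them. The law itself is described by its integrals, moving the dynamics from measures to
    functions, as the Cesaro means require. *)
Lemma state_law (k : nat) : exists nu : probability state R,
  law_independent P H (state_at p k%:Z) nu [pred i | k <= time i]%N /\
  forall f, bounded_measurable f ->
    \int[nu]_z f z = \int[nu0]_z iter k K f z.
Proof.
elim: k => [|k [nu [Hk nuE]]].
  exists nu0; split => // A s E mA us _ HE; exact: state_independent0.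
pose nu' : probability state R := distribution (nu \x PE)%E policy_step.
have nu'E A : measurable A -> nu' A = (nu \x PE)%E (policy_step @^-1` A) by [].
exists nu'; split; first exact: state_step Hk nu'E.
move=> f bf; rewrite (Rintegral_law_transfer nu'E bf) nuE; last exact: bm_transfer.
by under eq_Rintegral do rewrite -iterSr.
Qed.

Section cost.
Variable c : X * U -> R.
Hypothesis bc : @bounded_measurable _ (borel X * borel U)%type R c.

Let g (z : state) : R := \int[PN]_r c (z.2, gamma (z.1, r)).

Let bcg : @bounded_measurable _ (state * N)%type R
  (fun q => c (q.1.2, gamma (q.1.1, q.2))).
Proof.
apply: (@bm_comp _ _ _ (borel X * borel U)%type _ (fun q : state * N =>
  (q.1.2, gamma (q.1.1, q.2)))) bc.
apply: measurable_fun_pair; first exact: measurableT_comp.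
apply: measurableT_comp => //; apply: measurable_fun_pair => //.
exact: measurableT_comp.
Qed.

Lemma bm_expected_cost : bounded_measurable g.
Proof. exact: bm_fubini bcg. Qed.

Lemma expected_costE z : expected_cost c PN gamma z = (g z)%:E.
Proof. by rewrite /expected_cost (RintegralE PN (bm_pair bcg z)). Qed.

Let stage_cost (k : nat) om : R :=
  c (st p k%:Z om, gamma (history_at p k%:Z om, rnoise p k%:Z om)).

Let measurable_state_noise (k : nat) :
  measurable_fun [set: Omega] (fun om => (state_at p k%:Z om, rnoise p k%:Z om)).
Proof. by apply: measurable_fun_pair => //; exact: measurable_state_at. Qed.

Let bm_stage_cost k : bounded_measurable (stage_cost k).
Proof. exact: bm_comp (measurable_state_noise k) bcg. Qed.

Lemma Rintegral_stage_cost k :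
  \int[P]_om stage_cost k om = \int[nu0]_z iter k K g z.
Proof.
have [nu [Hk <-]] := state_law k; last exact: bm_expected_cost.
rewrite (Rintegral_fubini nu PN bcg).
rewrite (Rintegral_law (mu := P) (measurable_state_noise k) _ bcg)//.
move=> A mA; exact/esym/(law_independentE (noise_pair Hk) mA).
Qed.

Lemma average_costE T :
  ((T%:R^-1)%:E * 'E_P[fun om => (\sum_(k < T) stage_cost k om)%R] =
   (\int[nu0]_z cesaro K T g z)%:E)%E.
Proof.
rewrite unlock (RintegralE P (bm_sum _ _)) ?(bm_Rintegral_sum P _ bm_stage_cost)//.
rewrite -EFinM Rintegral_cesaro//; last exact: bm_expected_cost.
by congr (_ * _)%:E; apply: eq_bigr => k _; exact: Rintegral_stage_cost.
Qed.

End cost.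

End process.
End model.

(** * Convergence of the average cost *)

Theorem theorem13 (R : realType) (X Y : completeMetricType R)
    (U : pmetricType R)
    (X_separable : separable X) (Y_separable : separable Y)
    (U_compact : compact [set: U])
    (dW dV : measure_display) (W : measurableType dW) (V : measurableType dV)
    (PW : probability W R) (PV : probability V R)
    (F : {mfun (borel X * borel U * W)%type >-> borel X})
    (G : {mfun (borel X * V)%type >-> borel Y})
    (c : X * U -> R) (c_ge0 : forall xu, 0 <= c xu)
    (c_bounded : exists M, forall xu, c xu <= M) (c_continuous : continuous c)
    (kappa : int -> R.-pker (history Y U) ~> (borel X))
    (kappaE : is_cond_kernel PW PV F G kappa)
    (hB : weakly_continuous kappa)
    (hD : time_invariant PW PV F G kappa)
    (dN : measure_display) (N : measurableType dN) (PN : probability N R)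
    (gamma : {mfun (history Y U * N)%type >-> borel U})
    (gamma_optimal : optimal_policy PW PV F G c PN gamma)
    (Pbar : probability (state X Y U) R)
    (Pbar_invariant : invariant_measure PW PV F G PN gamma Pbar)
    (P0 : probability (history Y U) R)
    (P0E : forall A : set (history Y U), measurable A ->
      P0 A = pushforward Pbar (@past_history R X Y U) A)
    (mu : probability (borel X) R)
    (abs_cont : init_law PV G P0 mu `<< Pbar)
    (dO : measure_display) (Omega : measurableType dO)
    (P : probability Omega R) (p : process X Y U W V Omega N)
    (p_controlled : controlled_from PW PV F G 0 P PN (fun=> gamma) p)
    (p_init : forall A : set (state X Y U), measurable A ->
      P (state_at p 0 @^-1` A) = init_law PV G P0 mu A) :
  exists Qbar : probability (state X Y U) R,
    [/\ invariant_measure PW PV F G PN gamma Qbar,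
        (fun T : nat => (T%:R^-1)%:E *
           'E_P[fun om => (\sum_(k < T) c (st p k%:Z om,
                  gamma (history_at p k%:Z om, rnoise p k%:Z om)))%R])%E
          @ \oo --> (\int[Qbar]_z expected_cost c PN gamma z)%E &
        ergodic_measure PW PV F G PN gamma Pbar ->
        (\int[Pbar]_z expected_cost c PN gamma z)%E
          = optimal_cost PW PV F G c ->
        (forall A : set (state X Y U), measurable A -> Qbar A = Pbar A) /\
        average_cost c P p = optimal_cost PW PV F G c].
Proof.
have [Mc cM] := c_bounded.
(* Second countability of X and U makes the continuous cost measurable for the product of their
   Borel sigma-algebras. *)
have Xsc := separable_second_countable X_separable.
have Usc := compact_second_countable U_compact.
have bc : @bounded_measurable _ (borel X * borel U)%type R c.
  split; first exact: measurable_continuous_prod.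
  by exists Mc => xu; rewrite ger0_norm.
(* [init_law] is a bare set function; the law of Z_0 under P is a bundled probability that agrees
   with it on measurable sets. *)
pose nu0 : probability (state X Y U) R := distribution P (state_at p 0).
have nu0E A : measurable A -> P (state_at p 0 @^-1` A) = nu0 A by [].
have nu0_Pbar : nu0 `<< Pbar.
  by move=> A /abs_cont nA B mB BA; rewrite -nu0E// p_init//; exact: nA.
have bg := bm_expected_cost PN gamma bc.
have gE := expected_costE PN gamma bc.
have costE := average_costE p_controlled nu0E bc.
have PbarK := (invariant_stationary PW PV F G PN gamma Pbar).1 Pbar_invariant.
have [Q [QK QE]] := mean_ergodic_law PbarK nu0_Pbar.
have avg_cvg : (fun T : nat => (T%:R^-1)%:E *
     'E_P[fun om => (\sum_(k < T) c (st p k%:Z om,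
            gamma (history_at p k%:Z om, rnoise p k%:Z om)))%R])%E
    @ \oo --> (\int[Q]_z expected_cost c PN gamma z)%E.
  under eq_integral do rewrite gE.
  rewrite (RintegralE Q bg).
  apply: cvg_EFin; first by apply: nearW => T; rewrite costE.
  apply: cvg_trans (QE _ bg); apply: near_eq_cvg; apply: nearW => T /=.
  by rewrite costE.
exists Q; split => //; first exact/invariant_stationary.
move=> [_ Pbar_ergodic] Pbar_optimal.
have QPbar A : measurable A -> Q A = Pbar A.
  move=> mA; refine (mean_ergodic_extreme PbarK _ nu0_Pbar QE mA) => P1 P2 l l01.
  by move=> /invariant_stationary P1K /invariant_stationary; exact: Pbar_ergodic.
split=> //; rewrite -Pbar_optimal.
have -> : (\int[Pbar]_z expected_cost c PN gamma z =
    \int[Q]_z expected_cost c PN gamma z)%E.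
  by apply: eq_measure_integral => A mA _; exact/esym/QPbar.
(* The limsup of a convergent sequence is its limit. [average_cost] is written with the actions of
   p, which from time 0 on are gamma(S_k, R_k), so its sequence is the one treated above. *)
rewrite /average_cost limn_esup_lim.
apply: cvg_lim => //; apply: cvg_esups.
rewrite (_ : (fun T : nat => _) = (fun T : nat => (T%:R^-1)%:E *
     'E_P[fun om => (\sum_(k < T) c (st p k%:Z om,
            gamma (history_at p k%:Z om, rnoise p k%:Z om)))%R])%E)//.
apply/funext => T; congr (_ * 'E_P[_])%E; apply/funext => om.
apply: eq_bigr => k _; congr (c (_, _)).
by have [/(_ k%:Z om isT)[]] := p_controlled.
Qed.
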